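(* Let $\mathcal{B}=(\mathcal{L},\mathcal{M},\chi)$ be a tame bi-arrangement of hyperplanes in $\mathbb{C}^n$, with $\mathcal{L}=\{L_1,\ldots,L_l\}$ and $\mathcal{M}=\{M_1,\ldots,M_m\}$. Then: (a) $\mathcal{B}$ is exact. (b) The Orlik--Solomon bi-complex of $\mathcal{B}$ is the explicit subquotient $A_{\bullet,\bullet}(\mathcal{B})$ of $\Lambda^\bullet(e_1,\ldots,e_l)\otimes\Lambda^\bullet(f_1^\vee,\ldots,f_m^\vee)$ defined in the context, with its induced differentials $d',d''$ and its induced decomposition $A_{i,j}(\mathcal{B})=\bigoplus_{S}A_{i,j}^S(\mathcal{B})$ over the strata $S$ of codimension $i+j$.
   Context: Vector spaces are over $\mathbb{Q}$. Arrangements. An arrangement of hyperplanes $\mathcal{A}$ in $\mathbb{C}^n$ is a finite set of hyperplanes through the origin. A stratum is an intersection of some of the hyperplanes ($\mathbb{C}^n$ being the empty intersection); strata $\neq\mathbb{C}^n$ are called strict; $\mathscr{S}_r(\mathcal{A})$ is the set of strata of codimension $r$. $S^\perp$ is the space of linear forms vanishing on $S$. A decomposition $S=S_1\pitchfork\cdots\pitchfork S_r$ is an expression of $S$ as an intersection of strata $S_j$ with $S^\perp=\bigoplus_j S_j^\perp$ and such that every hyperplane of $\mathcal{A}$ containing $S$ contains some $S_j$; it is non-trivial if all the $S_j$ are strict. $S\stackrel{c}{\hookrightarrow}T$ denotes an inclusion of strata with $\dim T-\dim S=c$. Bi-arrangements. A bi-arrangement $\mathcal{B}=(\mathcal{L},\mathcal{M},\chi)$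 consists of two disjoint arrangements $\mathcal{L},\mathcal{M}$ in $\mathbb{C}^n$ and a coloring $\chi$ of the strict strata of $\mathcal{L}\sqcup\mathcal{M}$ by $\{\lambda,\mu\}$, with $\chi(L)=\lambda$ for $L\in\mathcal{L}$, $\chi(M)=\mu$ for $M\in\mathcal{M}$, and satisfying the Künneth condition: for every non-trivial decomposition $S=S'\pitchfork S''$, $\chi(S)=\chi(S')$ or $\chi(S)=\chi(S'')$. Orlik--Solomon bi-complex. A bi-complex is a family $C_{i,j}$ with $d':C_{i,j}\to C_{i-1,j}$, $d'':C_{i,j-1}\to C_{i,j}$, $d'd'=0$, $d''d''=0$, $d'd''=d''d'$. The Orlik--Solomon bi-complex of $\mathcal{B}$ is the datum, unique up to unique isomorphism, of finite-dimensional spaces $A_{i,j}^S$ ($i,j\ge 0$, $S$ a stratum of codimension $i+j$) and of maps $d'_{S,T}:A_{i,j}^S\to A_{i-1,j}^T$, $d''_{S,T}:A_{i,j-1}^T\to A_{i,j}^S$ for $S\stackrel{1}{\hookrightarrow}T$, such that: $A_{0,0}^{\mathbb{C}^n}=\mathbb{Q}$; for every stratum $\Sigma$, $A^{\le\Sigma}_{\bullet,\bullet}=\bigoplus_{S\supset\Sigma}A^S_{\bullet,\bullet}$ with the maps between strata containing $\Sigma$ is a bi-complex; for every strict $\Sigma$ of codimension $i+j$, if $\chi(\Sigma)=\lambda$ then $0\to A_{i,j}^\Sigma\xrightarrow{d'}\bigoplus_{\Sigma\stackrel{1}{\hookrightarrow}S}A_{i-1,j}^S\xrightarrow{d'}\bigoplus_{\Sigma\stackrel{2}{\hookrightarrow}T}A_{i-2,j}^T$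 is exact, and if $\chi(\Sigma)=\mu$ then $\bigoplus_{\Sigma\stackrel{2}{\hookrightarrow}T}A_{i,j-2}^T\xrightarrow{d''}\bigoplus_{\Sigma\stackrel{1}{\hookrightarrow}S}A_{i,j-1}^S\xrightarrow{d''}A_{i,j}^\Sigma\to0$ is exact. A strict stratum $\Sigma$ is exact if ($\chi(\Sigma)=\lambda$ and all the rows, i.e. the full $d'$-complexes $0\to A_{i,j}^\Sigma\to\bigoplus_{\Sigma\stackrel{1}{\hookrightarrow}S}A_{i-1,j}^S\to\cdots\to\bigoplus_{\Sigma\stackrel{i}{\hookrightarrow}Z}A_{0,j}^Z\to0$ for $i+j=\operatorname{codim}\Sigma$, are exact) or ($\chi(\Sigma)=\mu$ and all the columns, i.e. the full $d''$-complexes $0\to\bigoplus_{\Sigma\stackrel{j}{\hookrightarrow}Z}A_{i,0}^Z\to\cdots\to\bigoplus_{\Sigma\stackrel{1}{\hookrightarrow}S}A_{i,j-1}^S\to A_{i,j}^\Sigma\to0$ for $i+j=\operatorname{codim}\Sigma$, are exact). $\mathcal{B}$ is exact if all its strict strata are exact. Tameness. For $I\subset\{1,\ldots,l\}$, $J\subset\{1,\ldots,m\}$, put $L_I=\bigcap_{i\in I}L_i$, $M_J=\bigcap_{j\in J}M_j$. The pair $(I,J)$ is dependent if (the linear forms defining) the hyperplanes $L_i$ ($i\in I$), $M_j$ ($j\in J$) are linearly dependent, and independent otherwise; a circuit is a minimal dependent pair. A strict stratum $S$ is tame if either $\chi(S)=\lambda$ and there is $L_i\supset S$ such that $i$ belongs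 to no circuit $(I,J)$ with $S\subset L_I\cap M_J$ and $\chi(L_I\cap M_J)=\mu$; or $\chi(S)=\mu$ and there is $M_j\supset S$ such that $j$ belongs to no circuit $(I,J)$ with $S\subset L_I\cap M_J$ and $\chi(L_I\cap M_J)=\lambda$. $\mathcal{B}$ is tame if all its strict strata are tame. The subquotient. Let $E_{\bullet,\bullet}=\Lambda^\bullet(e_1,\ldots,e_l)\otimes\Lambda^\bullet(f_1^\vee,\ldots,f_m^\vee)$, with basis $e_I\otimes f_J^\vee$ in bidegree $(|I|,|J|)$, where $\Lambda^\bullet(f_1^\vee,\ldots,f_m^\vee)$ is identified with the dual of $\Lambda^\bullet(f_1,\ldots,f_m)$ (with $(f_J^\vee)$ dual to $(f_J)$). Let $d$ be the derivation of degree $-1$ of $\Lambda^\bullet(e_1,\ldots,e_l)$ (resp. of $\Lambda^\bullet(f_1,\ldots,f_m)$) with $d(e_i)=1$ (resp. $d(f_j)=1$), and put $d'=d\otimes\mathrm{id}$, $d''=\mathrm{id}\otimes d^\vee$ on $E_{\bullet,\bullet}$. Let $R\subset E_{\bullet,\bullet}$ be the span of the relations $(d(e_I))\otimes f_{J'}^\vee$ for all circuits $(I,J)$ with $\chi(L_I\cap M_J)=\lambda$ and all $J'\supset J$, where $(d(e_I))$ is the ideal of $\Lambda^\bullet(e_1,\ldots,e_l)$ generated by $d(e_I)$. Let $C\subset E_{\bullet,\bullet}^\vee$ be the span of the co-relations $e_{I'}^\vee\otimes(d(f_J))$ for all circuits $(I,J)$ with $\chi(L_I\cap M_J)=\mu$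 and all $I'\supset I$, where $(d(f_J))$ is the ideal of $\Lambda^\bullet(f_1,\ldots,f_m)$ generated by $d(f_J)$. With $C^\perp\subset E_{\bullet,\bullet}$ the annihilator of $C$, put $A_{\bullet,\bullet}(\mathcal{B})=C^\perp/(C^\perp\cap R)$. The differentials $d',d''$ pass to this subquotient. For $S$ a stratum of codimension $i+j$, $A_{i,j}^S(\mathcal{B})$ is the part of $A_{i,j}(\mathcal{B})$ coming from the span of the $e_I\otimes f_J^\vee$ with $|I|=i$, $|J|=j$, $L_I\cap M_J=S$; one has $A_{i,j}(\mathcal{B})=\bigoplus_{S}A^S_{i,j}(\mathcal{B})$ (the basis elements indexed by dependent pairs contribute nothing), and $d'_{S,T}$, $d''_{S,T}$ are the components of $d',d''$. *)

(* Defs.v *)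
From HB Require Import structures.
From mathcomp Require Import all_boot all_order all_algebra.
From mathcomp Require Import reals complex.

Set Implicit Arguments.
Unset Strict Implicit.
Unset Printing Implicit Defensive.

Import GRing.Theory.
Local Open Scope ring_scope.

Section Annihilators.
Variables (K : fieldType) (V : vectType K).

Definition proj_form (S : {vspace V}) (phi : 'Hom(V, K^o)) : 'Hom(V, K^o) :=
  (phi \o projv S)%VF.

Fact proj_form_linear S : linear (proj_form S).
Proof.
move=> a f g; apply/lfunP => v.
by rewrite comp_lfunE add_lfunE scale_lfunE add_lfunE scale_lfunE !comp_lfunE.
Qed.
HB.instance Definition _ S :=
  GRing.isLinear.Build _ _ _ _ (proj_form S) (proj_form_linear S).

(* S^\perp, the space of linear forms vanishing on S: a form vanishes on S iff
   its composite with a projection onto S is zero (see mem_annih). *)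
Definition annih (S : {vspace V}) : {vspace 'Hom(V, K^o)} :=
  lker (linfun (proj_form S)).

Lemma mem_annih (S : {vspace V}) (phi : 'Hom(V, K^o)) :
  reflect (forall v, v \in S -> phi v = 0) (phi \in annih S).
Proof.
rewrite memv_ker lfunE; apply: (iffP eqP) => [e v Sv | h].
  by rewrite -(projv_id Sv) -comp_lfunE -/(proj_form S phi) e lfunE.
by apply/lfunP => v; rewrite comp_lfunE h ?memv_proj // lfunE.
Qed.

(* The annihilator in V of a space of linear forms. *)
Definition coannih (C : {vspace 'Hom(V, K^o)}) : {vspace V} :=
  (\bigcap_(phi <- vbasis C) lker phi)%VS.

Lemma mem_coannih (C : {vspace 'Hom(V, K^o)}) (v : V) :
  reflect (forall phi, phi \in C -> phi v = 0) (v \in coannih C).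
Proof.
apply: (iffP idP) => [h phi Cphi | h].
  have {}h x : x \in vbasis C -> x v = 0.
    move=> Cx; apply/eqP; rewrite -memv_ker.
    by move: v h; apply/subvP; rewrite /coannih (big_rem x) //= capvSl.
  rewrite (coord_vbasis Cphi) sum_lfunE big1 // => i _.
  by rewrite scale_lfunE h ?scaler0 // mem_nth ?size_tuple.
rewrite /coannih big_seq; elim/big_ind: _ => [|U W|phi Cphi].
- exact: memvf.
- by rewrite memv_cap => -> ->.
- by rewrite memv_ker h // vbasis_mem.
Qed.

End Annihilators.

Section Subquotients.
Variables (F : fieldType) (V : vectType F) (U W : {vspace V}).

(* The space U / (U :&: W), realized on the library's complement U :\: W of
   U :&: W in U; the quotient map subquot_proj is only meaningful on U, where it
   is surjective with kernel U :&: W (see limg_subquot, subquot_proj_eq0). *)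
Definition subquot : vectType F := subvs_of (U :\: W)%VS.

Definition subquot_proj : 'Hom(V, subquot) :=
  (linfun (vsproj (U :\: W)) \o addv_pi1 U W)%VF.

Definition subquot_lift : 'Hom(subquot, V) := linfun vsval.

(* The map induced by f, well defined when f preserves U and U :&: W. *)
Definition subquot_map (f : 'End(V)) : 'End(subquot) :=
  (subquot_proj \o f \o subquot_lift)%VF.

Lemma subquot_liftK x : subquot_lift x \in U /\ subquot_proj (subquot_lift x) = x.
Proof.
have Dx : vsval x \in (U :\: W)%VS := subvsP x.
rewrite /subquot_lift /subquot_proj comp_lfunE !lfunE /=; split.
  exact: subvP (diffvSl _ _) _ Dx.
by apply: val_inj; rewrite /= vsprojK daddv_pi_id ?capv_diff.
Qed.

Lemma limg_subquot : (subquot_proj @: U)%VS = fullv.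
Proof.
apply/vspaceP => x; rewrite memvf.
by have [Ux <-] := subquot_liftK x; apply: memv_img.
Qed.

Lemma subquot_proj_eq0 u : u \in U -> (subquot_proj u == 0) = (u \in W).
Proof.
move=> Uu; have UWu : u \in (U + W)%VS by apply: subvP (addvSl _ _) _ Uu.
rewrite /subquot_proj comp_lfunE lfunE /= -val_eqE /= vsprojK ?memv_pi //.
apply/eqP/idP => [e | Wu].
  by rewrite -(addv_pi1_pi2 UWu) e add0r memv_pi2.
by have := addv_pi1_pi2 UWu; rewrite addv_pi2_id // => /(canRL (addrK _)) ->; rewrite subrr.
Qed.

End Subquotients.

Variant color := Lambda | Mu.

Definition color_to_bool c := if c is Lambda then true else false.
Definition bool_to_color (b : bool) := if b then Lambda else Mu.
Lemma color_to_boolK : cancel color_to_bool bool_to_color. Proof. by case. Qed.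
HB.instance Definition _ := Equality.copy color (can_type color_to_boolK).

Section Arrangements.
Variables (K : fieldType) (n l m : nat).
Local Notation V := 'rV[K]_n.
Variables (L : 'I_l -> {vspace V}) (M : 'I_m -> {vspace V}).

(* L_I :&: M_J; the empty intersection is the whole space. *)
Definition flat (I : {set 'I_l}) (J : {set 'I_m}) : {vspace V} :=
  ((\bigcap_(i in I) L i) :&: (\bigcap_(j in J) M j))%VS.

Definition flats : seq {vspace V} :=
  [seq flat p.1 p.2 | p : {set 'I_l} * {set 'I_m}].

Definition stratum : Type := seq_sub flats.
HB.instance Definition _ := Finite.on stratum.

Definition stratum_space (S : stratum) : {vspace V} := val S.
Local Coercion stratum_space : stratum >-> space.

Lemma flat_in_flats I J : flat I J \in flats.
Proof. by apply/imageP; exists (I, J). Qed.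

Definition flat_stratum I J : stratum := SeqSub (flat_in_flats I J).

Definition strict (S : stratum) : bool := (S : {vspace V}) != fullv.

Definition codim (S : stratum) : nat := (n - \dim S)%N.

Definition strata (r : nat) : Type := {S : stratum | codim S == r}.
HB.instance Definition _ r := Finite.on (strata r).

Fact codim_ambient : codim (flat_stratum set0 set0) == 0%N.
Proof.
rewrite /codim /stratum_space /= /flat !big_set0 capfv dimvf /dim /= mul1n.
by rewrite subnn.
Qed.
Definition ambient : strata 0 := exist _ (flat_stratum set0 set0) codim_ambient.

Definition nontrivial_decomposition (S S1 S2 : stratum) : Prop :=
  [/\ (S : {vspace V}) = (S1 :&: S2)%VS,
      annih S = (annih S1 + annih S2)%VS /\ directv (annih S1 + annih S2)%VS,
      (forall i, (S <= L i)%VS -> (S1 <= L i)%VS || (S2 <= L i)%VS),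
      (forall j, (S <= M j)%VS -> (S1 <= M j)%VS || (S2 <= M j)%VS)
    & strict S1 /\ strict S2].

(* A linear form defining the hyperplane H (see lker_form). *)
Definition form (H : {vspace V}) : 'Hom(V, K^o) := vpick (annih H).

Definition dependent (I : {set 'I_l}) (J : {set 'I_m}) : bool :=
  ~~ free ([seq form (L i) | i <- enum I] ++ [seq form (M j) | j <- enum J]).

Definition circuit (I : {set 'I_l}) (J : {set 'I_m}) : bool :=
  dependent I J &&
  [forall I' : {set 'I_l}, forall J' : {set 'I_m},
    [&& I' \subset I, J' \subset J & dependent I' J'] ==> (I' == I) && (J' == J)].

End Arrangements.

Coercion stratum_space : stratum >-> space.

Lemma lker_form (K : fieldType) (n : nat) (H : {vspace 'rV[K]_n}) :
  (\dim H).+1 = n -> lker (form H) = H.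
Proof.
move=> dimH; have dimV : \dim (@fullv K 'rV[K]_n) = n.
  by rewrite dimvf /dim /= mul1n.
have [v _ Hv] : exists2 v, v \in fullv & v \notin H.
  by apply/subvPn/negP => /dimvS; rewrite dimV -{1}dimH ltnn.
have [phi Hphi nz_phi] : exists2 phi, phi \in annih H & phi != 0.
  have : v - projv H v != 0 by rewrite subr_eq0; apply: contraNneq Hv => ->; apply: memv_proj.
  case/rV0Pn => k nz.
  pose f (u : 'rV[K]_n) : K^o := (u - projv H u) 0 k.
  have f_lin : linear f.
    by move=> a x y; rewrite /f linearP /= opprD addrACA -scalerBr !mxE.
  pose F : {linear 'rV[K]_n -> K^o} := HB.pack f (GRing.isLinear.Build _ _ _ _ f f_lin).
  exists (linfun F).
    by apply/mem_annih => u Hu; rewrite lfunE /= /f projv_id // subrr mxE.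
  apply: contraNneq nz => /lfunP/(_ v); rewrite lfunE /= /f => ->.
  by rewrite lfunE.
have nz : form H != 0.
  by rewrite vpick0; apply: contraNneq nz_phi => e; rewrite e memv0 in Hphi.
apply/esym/eqP; rewrite eqEdim; apply/andP; split.
  apply/subvP => u Hu; rewrite memv_ker; apply/eqP.
  exact: (mem_annih _ _ (memv_pick _)).
have ltV : (\dim (lker (form H)) < \dim (@fullv K 'rV[K]_n))%N.
  rewrite ltn_neqAle dimvS ?subvf // andbT; apply: contraNneq nz => e.
  have {}e : lker (form H) = fullv by apply/eqP; rewrite eqEdim subvf e leqnn.
  apply/eqP/lfunP => u; rewrite lfunE; apply/eqP.
  by rewrite -memv_ker e memvf.
by rewrite -ltnS (leq_trans ltV) // dimV -{1}dimH.
Qed.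

(* The arrangements L = {L_1, ..., L_l} and M = {M_1, ..., M_m} are enumerated
   without repetition; the value of chi at the non-strict stratum K^n is a dummy
   which is never used. *)
Record biarrangement (K : fieldType) (n l m : nat) := Biarrangement {
  bi_L : 'I_l -> {vspace 'rV[K]_n};
  bi_M : 'I_m -> {vspace 'rV[K]_n};
  bi_chi : stratum bi_L bi_M -> color;
  bi_dim_L : forall i, (\dim (bi_L i)).+1 = n;
  bi_dim_M : forall j, (\dim (bi_M j)).+1 = n;
  bi_inj_L : injective bi_L;
  bi_inj_M : injective bi_M;
  bi_disjoint : forall i j, bi_L i != bi_M j;
  bi_chi_L : forall i, bi_chi (flat_stratum bi_L bi_M [set i] set0) = Lambda;
  bi_chi_M : forall j, bi_chi (flat_stratum bi_L bi_M set0 [set j]) = Mu;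
  bi_Kunneth : forall S S1 S2, nontrivial_decomposition S S1 S2 ->
    bi_chi S = bi_chi S1 \/ bi_chi S = bi_chi S2
}.

Arguments bi_chi {K n l m} b S : rename.

Section OrlikSolomon.
Variables (K : fieldType) (n l m : nat) (B : biarrangement K n l m).
Local Notation stratum := (stratum (bi_L B) (bi_M B)).
Local Notation strata := (strata (bi_L B) (bi_M B)).
Local Notation flat_stratum := (flat_stratum (bi_L B) (bi_M B)).
Local Notation circuit := (circuit (bi_L B) (bi_M B)).
Local Notation chi := (bi_chi B).

Definition tame_stratum (S : stratum) : Prop :=
  (chi S = Lambda /\
   exists2 i, (S <= bi_L B i)%VS &
     forall I J, circuit I J -> i \in I -> (S <= flat_stratum I J)%VS ->
       chi (flat_stratum I J) <> Mu)
  \/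
  (chi S = Mu /\
   exists2 j, (S <= bi_M B j)%VS &
     forall I J, circuit I J -> j \in J -> (S <= flat_stratum I J)%VS ->
       chi (flat_stratum I J) <> Lambda).

Definition tame : Prop := forall S : stratum, strict S -> tame_stratum S.

(* The spaces A_{i,j}^S, for S of codimension i + j, with the identification of
   A_{0,0}^{K^n} with Q given by the vector bc_one, and the maps d'_{S,T} and
   d''_{S,T}. The maps are only meaningful when S is contained in T (the
   codimensions then differ by 1) and are not used otherwise. *)
Record bicomplex_data := BicomplexData {
  bc_space : forall i j : nat, strata (i + j) -> vectType rat;
  bc_one : bc_space (i := 0) (j := 0) (ambient (bi_L B) (bi_M B));
  bc_d1 : forall i j (S : strata (i.+1 + j)) (T : strata (i + j)),
    'Hom(bc_space S, bc_space T);
  bc_d2 : forall i j (S : strata (i + j.+1)) (T : strata (i + j)),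
    'Hom(bc_space T, bc_space S)
}.

(* The strata of codimension r containing Sigma. *)
Definition above (Sigma : stratum) (r : nat) : Type :=
  {S : strata r | (Sigma <= val S)%VS}.
HB.instance Definition _ Sigma r := Finite.on (above Sigma r).

Section Local.
Variables (A : bicomplex_data) (Sigma : stratum).

(* A^{<= Sigma}_{i,j}, the direct sum of the A_{i,j}^S over the strata S
   containing Sigma. *)
Definition local_sum (i j : nat) : Type :=
  forall S : above Sigma (i + j), bc_space A (val S).

Definition local_d1 i j (x : local_sum i.+1 j) : local_sum i j :=
  fun T => \sum_(S : above Sigma (i.+1 + j) | (val (val S) <= val (val T))%VS)
             bc_d1 A (val S) (val T) (x S).

Definition local_d2 i j (x : local_sum i j) : local_sum i j.+1 :=
  fun S => \sum_(T : above Sigma (i + j) | (val (val S) <= val (val T))%VS)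
             bc_d2 A (val S) (val T) (x T).

Definition local_bicomplex : Prop :=
  [/\ forall i j (x : local_sum i.+2 j) T, local_d1 (local_d1 x) T = 0,
      forall i j (x : local_sum i j) T, local_d2 (local_d2 x) T = 0
    & forall i j (x : local_sum i.+1 j) T,
        local_d1 (local_d2 x) T = local_d2 (local_d1 x) T].

(* Exactness at A^{<= Sigma}_{p,j} of its j-th row. If i + j = codim Sigma, this
   row is the complex 0 -> A_{i,j}^Sigma -> ... -> \bigoplus_Z A_{0,j}^Z -> 0,
   since then A^{<= Sigma}_{i,j} is A_{i,j}^Sigma and A^{<= Sigma}_{i+1,j} is 0. *)
Definition row_exact_at (p j : nat) : Prop :=
  forall x : local_sum p j,
    match p return local_sum p j -> Prop with
    | 0 => fun=> True
    | p'.+1 => fun x => forall T, local_d1 x T = 0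
    end x ->
  exists y : local_sum p.+1 j, forall S, local_d1 y S = x S.

(* Likewise for the i-th column, where A^{<= Sigma}_{i,-1} is 0. *)
Definition column_exact_at (i q : nat) : Prop :=
  match q with
  | 0 => forall x : local_sum i 0,
      (forall S, local_d2 x S = 0) -> forall T, x T = 0
  | q'.+1 => forall x : local_sum i q'.+1,
      (forall S, local_d2 x S = 0) ->
      exists y : local_sum i q', forall T, local_d2 y T = x T
  end.

(* The exactness of 0 -> A_{i,j} -> A_{i-1,j} -> A_{i-2,j} (resp. of
   A_{i,j-2} -> A_{i,j-1} -> A_{i,j} -> 0), i.e. at p = i and p = i - 1 (resp. at
   q = j and q = j - 1), terms with a negative index being 0. *)
Definition OS_condition : Prop :=
  forall i j, (i + j)%N = codim Sigma ->
    match chi Sigma with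
    | Lambda => forall p, p = i \/ p.+1 = i -> row_exact_at p j
    | Mu => forall q, q = j \/ q.+1 = j -> column_exact_at i q
    end.

Definition exact_stratum : Prop :=
  forall i j, (i + j)%N = codim Sigma ->
    match chi Sigma with
    | Lambda => forall p, (p <= i)%N -> row_exact_at p j
    | Mu => forall q, (q <= j)%N -> column_exact_at i q
    end.

End Local.

Definition is_Orlik_Solomon (A : bicomplex_data) : Prop :=
  [/\ bc_one A != 0 /\ fullv = <[bc_one A]>%VS,
      forall Sigma : stratum, local_bicomplex A Sigma
    & forall Sigma : stratum, strict Sigma -> OS_condition A Sigma].

(* The choice of A does not matter: the Orlik-Solomon bi-complex is unique up to
   unique isomorphism. *)
Definition is_exact : Prop :=
  forall A, is_Orlik_Solomon A ->
  forall Sigma : stratum, strict Sigma -> exact_stratum A Sigma.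

End OrlikSolomon.

Section Exterior.
Variable k : nat.

(* \Lambda^*(e_1, ..., e_k), in coordinates in the basis of the
   e_I = e_{i_1} /\ ... /\ e_{i_r}, for I = {i_1 < ... < i_r}. *)
Local Notation ext := {ffun {set 'I_k} -> rat^o}.

Definition ext_basis (I : {set 'I_k}) : ext := [ffun I' => (I' == I)%:R].

Definition inversions (I J : {set 'I_k}) : nat :=
  #|[set p in setX I J | (p.2 < p.1)%N]|.

(* e_I /\ e_J is 0 if I and J meet, and (-1) ^+ inversions I J *: e_(I :|: J)
   otherwise. *)
Definition wedge (x y : ext) : ext :=
  [ffun I : {set 'I_k} => \sum_(J : {set 'I_k} | J \subset I)
    (-1) ^+ inversions J (I :\: J) * (x J * y (I :\: J))].

(* The derivation d of degree -1 with d(e_i) = 1: it maps e_I to the sum over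
   i \in I of (-1) ^+ #{k \in I, k < i} *: e_(I :\ i). *)
Definition ext_d (x : ext) : ext :=
  [ffun I : {set 'I_k} => \sum_(i | i \notin I)
    (-1) ^+ #|[set h in I | (h < i)%N]| * x (i |: I)].

(* The transpose of ext_d, in coordinates in the dual basis of the e_I. *)
Definition ext_d_dual (x : ext) : ext :=
  [ffun I : {set 'I_k} => \sum_(J : {set 'I_k}) x J * ext_d (ext_basis I) J].

Definition ext_ideal (x : ext) : {vspace ext} :=
  <<[seq wedge (ext_basis p.1) (wedge x (ext_basis p.2))
      | p : {set 'I_k} * {set 'I_k}]>>%VS.

Fact ext_d_linear : linear ext_d.
Proof.
move=> a x y; apply/ffunP => I; rewrite !ffunE scaler_sumr -big_split.
by apply: eq_bigr => i _; rewrite !ffunE mulrDr scalerAr.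
Qed.
HB.instance Definition _ := GRing.isLinear.Build _ _ _ _ ext_d ext_d_linear.

Fact ext_d_dual_linear : linear ext_d_dual.
Proof.
move=> a x y; apply/ffunP => I; rewrite !ffunE scaler_sumr -big_split.
by apply: eq_bigr => J _; rewrite !ffunE mulrDl scalerAl.
Qed.
HB.instance Definition _ :=
  GRing.isLinear.Build _ _ _ _ ext_d_dual ext_d_dual_linear.

End Exterior.

Section Tensor.
Variables l m : nat.

(* \Lambda^*(e_1, ..., e_l) \otimes \Lambda^*(f_1, ..., f_m)^\vee, in coordinates
   in the basis of the e_I \otimes f_J^\vee. *)
Local Notation E := {ffun {set 'I_l} * {set 'I_m} -> rat^o}.

Definition tensor (x : {ffun {set 'I_l} -> rat^o})
    (y : {ffun {set 'I_m} -> rat^o}) : E :=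
  [ffun p => x p.1 * y p.2].

Definition tensor_d1 (x : E) : E :=
  [ffun p => ext_d [ffun I => x (I, p.2)] p.1].

Definition tensor_d2 (x : E) : E :=
  [ffun p => ext_d_dual [ffun J => x (p.1, J)] p.2].

(* x |-> x \otimes f_J^\vee *)
Definition tensor_dual_basis (J : {set 'I_m}) (x : {ffun {set 'I_l} -> rat^o}) : E :=
  tensor x (ext_basis J).

Definition cotensor_fun (I : {set 'I_l}) (y : {ffun {set 'I_m} -> rat^o}) (x : E) :
    rat^o :=
  \sum_(J : {set 'I_m}) y J * x (I, J).

(* y |-> e_I^\vee \otimes y, as a linear form on E *)
Definition cotensor (I : {set 'I_l}) (y : {ffun {set 'I_m} -> rat^o}) :
    'Hom(E, rat^o) :=
  linfun (cotensor_fun I y).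

Fact tensor_d1_linear : linear tensor_d1.
Proof.
move=> a x y; apply/ffunP => p; rewrite !ffunE scaler_sumr -big_split.
by apply: eq_bigr => i _; rewrite !ffunE mulrDr scalerAr.
Qed.
HB.instance Definition _ :=
  GRing.isLinear.Build _ _ _ _ tensor_d1 tensor_d1_linear.

Fact tensor_d2_linear : linear tensor_d2.
Proof.
move=> a x y; apply/ffunP => p; rewrite !ffunE scaler_sumr -big_split.
by apply: eq_bigr => i _; rewrite !ffunE mulrDl scalerAl.
Qed.
HB.instance Definition _ :=
  GRing.isLinear.Build _ _ _ _ tensor_d2 tensor_d2_linear.

Fact tensor_dual_basis_linear J : linear (tensor_dual_basis J).
Proof. by move=> a x y; apply/ffunP => p; rewrite !ffunE mulrDl scalerAl. Qed.
HB.instance Definition _ J :=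
  GRing.isLinear.Build _ _ _ _ (tensor_dual_basis J) (tensor_dual_basis_linear J).

Fact cotensor_fun_linear I y : linear (cotensor_fun I y).
Proof.
move=> a x x'; rewrite /cotensor_fun scaler_sumr -big_split.
by apply: eq_bigr => J _; rewrite !ffunE mulrDr scalerAr.
Qed.
HB.instance Definition _ I y :=
  GRing.isLinear.Build _ _ _ _ (cotensor_fun I y) (cotensor_fun_linear I y).

Fact cotensor_linear I : linear (cotensor I).
Proof.
move=> a y y'; apply/lfunP => x; rewrite add_lfunE scale_lfunE !lfunE /=.
rewrite /cotensor_fun scaler_sumr -big_split.
by apply: eq_bigr => J _; rewrite !ffunE mulrDl scalerAl.
Qed.
HB.instance Definition _ I :=
  GRing.isLinear.Build _ _ _ _ (cotensor I) (cotensor_linear I).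

End Tensor.

Section Subquotient.
Variables (K : fieldType) (n l m : nat) (B : biarrangement K n l m).
Local Notation stratum := (stratum (bi_L B) (bi_M B)).
Local Notation strata := (strata (bi_L B) (bi_M B)).
Local Notation flat_stratum := (flat_stratum (bi_L B) (bi_M B)).
Local Notation circuit := (circuit (bi_L B) (bi_M B)).
Local Notation E := {ffun {set 'I_l} * {set 'I_m} -> rat^o}.

Definition relations : {vspace E} :=
  (\sum_(p : {set 'I_l} * {set 'I_m} |
          circuit p.1 p.2 && (bi_chi B (flat_stratum p.1 p.2) == Lambda))
   \sum_(J : {set 'I_m} | p.2 \subset J)
     linfun (tensor_dual_basis J) @: ext_ideal (ext_d (ext_basis p.1)))%VS.

Definition corelations : {vspace 'Hom(E, rat^o)} :=
  (\sum_(p : {set 'I_l} * {set 'I_m} |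
          circuit p.1 p.2 && (bi_chi B (flat_stratum p.1 p.2) == Mu))
   \sum_(I : {set 'I_l} | p.1 \subset I)
     linfun (cotensor I) @: ext_ideal (ext_d (ext_basis p.2)))%VS.

Definition corelations_perp : {vspace E} := coannih corelations.

Local Notation U := corelations_perp.
Local Notation W := relations.

(* A_{*,*}(B) *)
Definition expl : vectType rat := subquot U W.

Definition expl_d1 : 'End(expl) := subquot_map U W (linfun (@tensor_d1 l m)).
Definition expl_d2 : 'End(expl) := subquot_map U W (linfun (@tensor_d2 l m)).

Definition passes_to_subquotient (d : 'End(E)) : Prop :=
  (d @: U <= U)%VS /\ (d @: (U :&: W) <= U :&: W)%VS.

(* The span of the e_I \otimes f_J^\vee with (I, J) satisfying P. *)
Definition basis_span (P : pred ({set 'I_l} * {set 'I_m})) : {vspace E} :=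
  <<[seq tensor (ext_basis p.1) (ext_basis p.2) | p in P]>>%VS.

(* A_{i,j}(B) *)
Definition expl_bidegree (i j : nat) : {vspace expl} :=
  (subquot_proj U W @:
    (U :&: basis_span [pred p : {set 'I_l} * {set 'I_m} |
                        (#|p.1| == i) && (#|p.2| == j)]))%VS.

(* A_{i,j}^S(B) *)
Definition expl_stratum (i j : nat) (S : stratum) : {vspace expl} :=
  (subquot_proj U W @:
    (U :&: basis_span [pred p : {set 'I_l} * {set 'I_m} |
                  [&& #|p.1| == i, #|p.2| == j & flat_stratum p.1 p.2 == S]]))%VS.

Definition expl_space (i j : nat) (S : strata (i + j)) : vectType rat :=
  subvs_of (expl_stratum i j (val S)).

Definition expl_incl i j (S : strata (i + j)) : 'Hom(expl_space S, expl) :=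
  linfun vsval.

(* The projection onto A_{i,j}^T(B) in the direct sum decomposition of
   A_{i,j}(B). *)
Definition expl_component i j (T : strata (i + j)) : 'Hom(expl, expl_space T) :=
  (linfun (vsproj (expl_stratum i j (val T))) \o
   sumv_pi (\sum_(S : strata (i + j)) expl_stratum i j (val S))%VS T)%VF.

(* The class of 1 = e_set0 \otimes f_set0^\vee *)
Definition expl_one : expl_space (i := 0) (j := 0) (ambient (bi_L B) (bi_M B)) :=
  vsproj _ (subquot_proj U W (tensor (ext_basis set0) (ext_basis set0))).

Definition expl_bicomplex : bicomplex_data B := {|
  bc_space := expl_space;
  bc_one := expl_one;
  bc_d1 i j S T := (expl_component T \o expl_d1 \o expl_incl S)%VF;
  bc_d2 i j S T := (expl_component S \o expl_d2 \o expl_incl T)%VF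
|}.

(* A_{i,j}(B) is the direct sum of the A_{i,j}^S(B), and the differentials are
   the sums of their components d'_{S,T}, d''_{S,T} for S contained in T. *)
Definition expl_decomposition : Prop :=
  [/\ forall i j,
        expl_bidegree i j = (\sum_(S : strata (i + j)) expl_stratum i j (val S))%VS
        /\ directv (\sum_(S : strata (i + j)) expl_stratum i j (val S))%VS,
      forall i j (S : strata (i.+1 + j)) (x : expl_space S),
        expl_d1 (expl_incl S x) =
        \sum_(T : strata (i + j) | (val S <= val T)%VS)
          expl_incl T (bc_d1 expl_bicomplex S T x)
    & forall i j (T : strata (i + j)) (x : expl_space T),
        expl_d2 (expl_incl T x) =
        \sum_(S : strata (i + j.+1) | (val S <= val T)%VS)
          expl_incl S (bc_d2 expl_bicomplex S T x)].

End Subquotient.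

(* Main.v *)
From HB Require Import structures.
Require Import Defs.
From mathcomp Require Import all_boot all_order all_algebra.
From mathcomp Require boolp.

(* Both halves rest on contracting homotopies of the subquotient C^perp / (C^perp :&: R).
   If Sigma has colour lambda and L_i makes it tame, left multiplication by e_i
   preserves R (a family of ideals) and, on the part indexed by strata containing
   Sigma, also C^perp: tameness says that no mu-circuit over Sigma involves i.
   Since d'(e_i x) + e_i d'(x) = x, the rows are exact. Dually, contraction by f_j
   contracts the columns when Sigma has colour mu. Tameness also makes every
   dependent basis element lie in R or vanish on C^perp, which gives the
   decomposition over strata. So the explicit bi-complex is an exact
   Orlik-Solomon bi-complex, and an arbitrary one is compared with it by induction
   on the codimension: A_{i,j}^Sigma is the kernel (colour lambda) or cokernel
   (colour mu) of a differential between strata of smaller codimension. *)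

Set Implicit Arguments.
Unset Strict Implicit.
Unset Printing Implicit Defensive.

Import GRing.Theory.
Local Open Scope ring_scope.

(** * Exterior algebra *)

Section ExteriorOperators.
Variable k : nat.
Local Notation ext := {ffun {set 'I_k} -> rat^o}.
Implicit Types (x y : ext) (i j h : 'I_k) (I J K A : {set 'I_k}).

(** Truncating a vector to a set of basis elements $e_I \otimes f_J^\vee$ preserves $R$ and
    $C^\perp$ as soon as the set depends only on $|I|$, $|J|$ and the flat $L_I \cap M_J$. Indeed
    all terms of a generator attached to a circuit have the same degree and the same flat, because
    dropping one hyperplane from a circuit does not change its intersection. Both the splitting over
    strata and the restriction to strata above $\Sigma$ come from this. The two differentials are
    not symmetric with respect to that restriction: $d'$ enlarges flats and so preserves the part
    above $\Sigma$, whereas $d''$ leaves it and has to be truncated, in a way that must still be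
    compatible with $d'$. In the comparison of two bi-complexes, only one differential determines
    the map on a new stratum; compatibility with the other one is where $d'd'' = d''d'$ enters. *)

Definition ext_sign i I : rat := (-1) ^+ #|[set h in I | (h < i)%N]|.

(** Left multiplication by $e_i$; the next operator is contraction by the $i$-th dual basis vector.
    As [h < i] is strict, [ext_sign i] takes the same value at [I] and at [I :\ i]. *)
Definition ext_mul i x : ext :=
  [ffun I : {set 'I_k} => if i \in I then ext_sign i I * x (I :\ i) else 0].

Definition ext_contract i x : ext :=
  [ffun I : {set 'I_k} => if i \in I then 0 else ext_sign i I * x (i |: I)].

Fact ext_mul_linear i : linear (ext_mul i).
Proof.
move=> a x y; apply/ffunP => I; rewrite !ffunE; case: ifP => _; last first.
  by rewrite scaler0 addr0.
by rewrite mulrDr scalerAr.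
Qed.
HB.instance Definition _ i :=
  GRing.isLinear.Build _ _ _ _ (ext_mul i) (ext_mul_linear i).

Fact ext_contract_linear i : linear (ext_contract i).
Proof.
move=> a x y; apply/ffunP => I; rewrite !ffunE; case: ifP => _.
  by rewrite scaler0 addr0.
by rewrite mulrDr scalerAr.
Qed.
HB.instance Definition _ i :=
  GRing.isLinear.Build _ _ _ _ (ext_contract i) (ext_contract_linear i).

Lemma ext_signU1 i j I : j \notin I ->
  ext_sign i (j |: I) = (-1) ^+ (j < i)%N * ext_sign i I.
Proof.
move=> jI; rewrite /ext_sign; case: ltnP => ji.
  have -> : [set h in j |: I | (h < i)%N] = j |: [set h in I | (h < i)%N].
    apply/setP => h; rewrite !inE andb_orl; case: eqP => // ->.
    by rewrite ji.
  by rewrite cardsU1 inE (negPf jI) /= exprD.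
rewrite mul1r; congr (_ ^+ #|pred_of_set _|); apply/setP => h.
rewrite !inE; case: eqP => // ->.
by rewrite ltnNge ji !andbF.
Qed.

Lemma ext_signD1 i j I : j \in I ->
  ext_sign i (I :\ j) = (-1) ^+ (j < i)%N * ext_sign i I.
Proof.
by move=> jI; rewrite -{2}(setD1K jI) ext_signU1 ?setD11 // mulrA -expr2 sqrr_sign mul1r.
Qed.

Lemma ext_sign_sqr i I : ext_sign i I * ext_sign i I = 1.
Proof. by rewrite -expr2 sqrr_sign. Qed.

Lemma ltn_sign_swap i j : i != j ->
  (-1) ^+ (i < j)%N = - (-1) ^+ (j < i)%N :> rat.
Proof. by rewrite -val_eqE /=; case: ltngtP => //= _ _; rewrite ?opprK. Qed.

(** The canonical anticommutation relations. Since $d$ is the sum of all contractions and $d^\vee$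
    the sum of all multiplications, both contracting homotopies are read off from them. *)
Lemma ext_contract_mul i j x :
  ext_contract j (ext_mul i x) + ext_mul i (ext_contract j x) = (j == i)%:R *: x.
Proof.
apply/ffunP => I; rewrite !ffunE; case: eqP => [-> | /eqP ji].
  rewrite scale1r setU11 setD11; case: ifPn => iI.
    by rewrite setD1K // ext_signD1 // ltnn mul1r mulrA ext_sign_sqr mul1r add0r.
  by rewrite setU1K // ext_signU1 // ltnn mul1r mulrA ext_sign_sqr mul1r addr0.
rewrite scale0r !inE (eq_sym i) (negPf ji) /=.
case: (boolP (j \in I)) => jI; case: (boolP (i \in I)) => iI;
  rewrite ?mulr0 ?addr0 //.
have -> : j |: I :\ i = (j |: I) :\ i.
  by apply/setP => h; rewrite !inE; case: eqP => // ->; rewrite ji.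
rewrite ext_signU1 // ext_signD1 // (ltn_sign_swap ji).
by rewrite mulNr mulNr mulrN !mulrA [_ * ext_sign j I]mulrC -!mulrA
   [ext_sign i I * (_ * _)]mulrCA addNr.
Qed.

Lemma ext_mul_anti i j x : ext_mul i (ext_mul j x) = - ext_mul j (ext_mul i x).
Proof.
apply/ffunP => I; rewrite !ffunE !inE.
have [-> | ij] := eqVneq i j; first by rewrite ?mulr0 ?if_same ?oppr0.
rewrite /=; case: (boolP (i \in I)) => iI; case: (boolP (j \in I)) => jI;
  rewrite ?mulr0 ?oppr0 //.
rewrite !ext_signD1 // (ltn_sign_swap ij) setDDl setUC -setDDl.
by rewrite mulNr mulNr mulrN !mulrA; congr (- (_ * _)); rewrite mulrAC [RHS]mulrAC;
  congr (_ * _); rewrite mulrC.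
Qed.

Lemma ext_contract_anti i j x :
  ext_contract i (ext_contract j x) = - ext_contract j (ext_contract i x).
Proof.
apply/ffunP => I; rewrite !ffunE !inE.
have [-> | ij] := eqVneq i j; first by rewrite ?mulr0 ?if_same ?oppr0.
rewrite /=; case: (boolP (i \in I)) => iI; case: (boolP (j \in I)) => jI;
  rewrite ?mulr0 ?oppr0 //.
rewrite !ext_signU1 // (ltn_sign_swap ij) setUCA.
by rewrite mulNr mulNr mulrN !mulrA; congr (- (_ * _)); rewrite mulrAC [RHS]mulrAC;
  congr (_ * _); rewrite mulrC.
Qed.

Lemma ext_dE x : ext_d x = \sum_i ext_contract i x.
Proof.
apply/ffunP => I; rewrite sum_ffunE ffunE big_mkcond; apply: eq_bigr => i _.
by rewrite !ffunE; case: (i \in I).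
Qed.

Lemma ext_basisE I A : ext_basis I A = (A == I)%:R. Proof. by rewrite ffunE. Qed.

Lemma ext_d_dualE x : ext_d_dual x = \sum_i ext_mul i x.
Proof.
apply/ffunP => I; rewrite sum_ffunE ffunE.
under eq_bigr => J _ do rewrite ffunE big_mkcond mulr_sumr.
rewrite exchange_big; apply: eq_bigr => i _; rewrite !ffunE; case: ifPn => iI.
  rewrite (bigD1 (I :\ i)) //= setD11 /= ext_basisE setD1K // eqxx mulr1 big1 ?addr0.
    by rewrite mulrC -/(ext_sign i _) ext_signD1 // ltnn mul1r.
  move=> J /negP JI; case: ifP => iJ; rewrite ?mulr0 // ext_basisE.
  by case: eqP => [e|]; rewrite ?mulr0 //; case: JI; rewrite -e setU1K.
rewrite big1 // => J _; case: ifP; rewrite ?mulr0 // ext_basisE.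
by case: eqP => [e|]; rewrite ?mulr0 //; move: iI; rewrite -e setU11.
Qed.

(** Exchanging the two indices shows that the double sum equals its own opposite, and 2 is
    invertible in $\mathbb{Q}$. *)
Lemma anti_sum0 (f : 'I_k -> ext -> ext) x :
  (forall i, additive (f i)) -> (forall i j, f i (f j x) = - f j (f i x)) ->
  \sum_i f i (\sum_j f j x) = 0.
Proof.
move=> fa fN; pose g i : {additive ext -> ext} := HB.pack (f i) (GRing.isZmodMorphism.Build
  _ _ _ (fa i)).
have e : \sum_i f i (\sum_j f j x) = \sum_i \sum_j f i (f j x).
  by apply: eq_bigr => i _; rewrite -[f i]/(g i : _ -> _) raddf_sum.
have : \sum_i \sum_j f i (f j x) = - \sum_i \sum_j f i (f j x).
  rewrite [LHS]exchange_big /= -sumrN; apply: eq_bigr => i _.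
  by rewrite -sumrN; apply: eq_bigr => j _; rewrite fN.
move/eqP; rewrite -addr_eq0 -mulr2n -scaler_nat scaler_eq0 Num.Theory.pnatr_eq0 /= e.
by move/eqP.
Qed.

Lemma ext_d_sqr0 x : ext_d (ext_d x) = 0.
Proof.
rewrite !ext_dE; apply: (@anti_sum0 ext_contract) => [i|i j]; last exact: ext_contract_anti.
exact: raddfB.
Qed.

Lemma ext_d_dual_sqr0 x : ext_d_dual (ext_d_dual x) = 0.
Proof.
rewrite !ext_d_dualE; apply: (@anti_sum0 ext_mul) => [i|i j]; last exact: ext_mul_anti.
exact: raddfB.
Qed.

Lemma ext_d_mul i x : ext_d (ext_mul i x) + ext_mul i (ext_d x) = x.
Proof.
rewrite !ext_dE linear_sum -big_split /= (bigD1 i) //= ext_contract_mul eqxx scale1r.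
by rewrite big1 ?addr0 // => j /negPf ji; rewrite ext_contract_mul ji scale0r.
Qed.

Lemma ext_d_dual_contract i x :
  ext_d_dual (ext_contract i x) + ext_contract i (ext_d_dual x) = x.
Proof.
rewrite !ext_d_dualE linear_sum addrC -big_split /= (bigD1 i) //=.
rewrite ext_contract_mul eqxx scale1r big1 ?addr0 // => j /negPf ji.
by rewrite ext_contract_mul eq_sym ji scale0r.
Qed.

(** Pairs each set avoiding [i] with the set obtained by inserting [i]. It turns a contraction of a
    vector of $C^\perp$ into a multiplication inside the ideal of co-relations. *)
Lemma ext_mul_transpose i x y :
  \sum_I ext_mul i x I * y I = \sum_I x I * ext_contract i y I.
Proof.
rewrite (bigID (fun I => i \in I)) /= [X in _ + X]big1 ?addr0; last first.
  by move=> I /negPf iI; rewrite !ffunE iI mul0r.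
rewrite [RHS](bigID (fun I => i \notin I)) /= [X in _ = _ + X]big1 ?addr0; last first.
  by move=> I /negPn iI; rewrite !ffunE iI mulr0.
rewrite (reindex_onto (fun I => i |: I) (fun I => I :\ i)) /=; last first.
  by move=> I iI; rewrite setD1K.
apply: eq_big => [I | I /andP [_ /eqP e]].
  rewrite setU11 /=; apply/eqP/idP => [<-|]; first by rewrite setD11.
  exact: setU1K.
have iI : i \notin I by rewrite -e setD11.
rewrite !ffunE setU11 setU1K // (negPf iI) ext_signU1 // ltnn mul1r.
by rewrite mulrAC mulrC.
Qed.

Lemma ext_d_transpose x y :
  \sum_I ext_d x I * y I = \sum_I x I * ext_d_dual y I.
Proof.
rewrite ext_dE ext_d_dualE.
under eq_bigr => I _ do rewrite sum_ffunE mulr_suml.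
under [RHS]eq_bigr => I _ do rewrite sum_ffunE mulr_sumr.
rewrite exchange_big [RHS]exchange_big; apply: eq_bigr => i _ /=.
under [RHS]eq_bigr => I _ do rewrite mulrC.
by rewrite ext_mul_transpose; apply: eq_bigr => I _; rewrite mulrC.
Qed.

Lemma wedge_basisl K y A : wedge (ext_basis K) y A =
  if K \subset A then (-1) ^+ inversions K (A :\: K) * y (A :\: K) else 0.
Proof.
rewrite ffunE; case: ifPn => KA.
  rewrite (bigD1 K) //= ext_basisE eqxx mul1r big1 ?addr0 // => J /andP [_ /negPf JK].
  by rewrite ext_basisE JK mul0r mulr0.
rewrite big1 // => J JA; rewrite ext_basisE; case: eqP => [e|]; last by rewrite mul0r mulr0.
by rewrite -e JA in KA.
Qed.

Lemma wedge_basisr K y A : wedge y (ext_basis K) A =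
  if K \subset A then (-1) ^+ inversions (A :\: K) K * y (A :\: K) else 0.
Proof.
rewrite ffunE; case: ifPn => KA.
  have DD : A :\: (A :\: K) = K by rewrite setDDr setDv set0U; apply/setIidPr.
  rewrite (bigD1 (A :\: K)) ?subsetDl //= DD ext_basisE eqxx mulr1 big1 ?addr0 //.
  move=> J /andP [JA JK]; rewrite ext_basisE; case: eqP => [e|]; last by rewrite !mulr0.
  by case/eqP: JK; rewrite -e setDDr setDv set0U; apply/esym/setIidPr.
rewrite big1 // => J JA; rewrite ext_basisE; case: eqP => [e|]; last by rewrite !mulr0.
by rewrite -e subsetDl in KA.
Qed.

Lemma wedge0l y : wedge (ext_basis set0) y = y.
Proof.
apply/ffunP => A; rewrite wedge_basisl sub0set setD0 /inversions.
rewrite (_ : [set _ in _ | _] = set0) ?cards0 ?mul1r //.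
by apply/setP => -[a b]; rewrite !inE.
Qed.

Lemma wedge0r y : wedge y (ext_basis set0) = y.
Proof.
apply/ffunP => A; rewrite wedge_basisr sub0set setD0 /inversions.
rewrite (_ : [set _ in _ | _] = set0) ?cards0 ?mul1r //.
by apply/setP => -[a b]; rewrite !inE /= andbF.
Qed.

(** The inversions with first entry [i] are counted by [ext_sign i A]; the others are those of
    [K]. *)
Lemma inversionsU1 i K A : i \notin K ->
  (-1) ^+ inversions (i |: K) A = ext_sign i A * (-1) ^+ inversions K A :> rat.
Proof.
move=> iK; rewrite /ext_sign -exprD /inversions; congr (_ ^+ _).
rewrite -(card_imset (mem [set h in A | _]) (f := pair i)) => [|? ? [] //].
rewrite -cardsUI [X in (_ = _ + X)%N](_ : _ = 0%N) ?addn0; last first.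
  apply/eqP; rewrite cards_eq0; apply/eqP/setP => -[a b]; rewrite !inE /=.
  apply/negP => /andP [/imsetP [h _ [-> _]]].
  by rewrite (negPf iK).
congr #|pred_of_set _|; apply/setP => -[a b]; rewrite !inE /= -andbA andb_orl andbA;
  congr (_ || _); last by rewrite andbA.
apply/idP/imsetP => [/andP [/andP [/eqP -> bA] ba] | [h]].
  by exists b => //; rewrite inE bA.
by rewrite inE => /andP [hA hi] [-> ->]; rewrite eqxx hA.
Qed.

Lemma ext_sign_setD i K A : K \subset A ->
  ext_sign i A = ext_sign i K * ext_sign i (A :\: K).
Proof.
move=> /setIidPr KA; rewrite /ext_sign -exprD.
rewrite -(cardsID K [set h in A | (h < i)%N]); congr (_ ^+ _); congr (_ + _)%N;
  congr #|pred_of_set _|.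
  by apply/setP => h; rewrite -{2}KA !inE andbAC.
by apply/setP => h; rewrite !inE andbA.
Qed.

Lemma ext_mul_wedge i K y : i \notin K ->
  ext_mul i (wedge (ext_basis K) y) =
  ext_sign i K *: wedge (ext_basis (i |: K)) y.
Proof.
move=> iK; apply/ffunP => A; rewrite [LHS]ffunE [RHS]ffunE !wedge_basisl.
rewrite subUset sub1set subsetD1 iK andbT.
case: (boolP (i \in A)) => iA; last by rewrite scaler0.
case: ifPn => KA; rewrite ?mulr0 ?scaler0 //= setDDl.
have -> : ext_sign i A = ext_sign i (A :\ i) by rewrite ext_signD1 // ltnn mul1r.
rewrite (@ext_sign_setD i K) ?subsetD1 ?KA // setDDl inversionsU1 //.
by rewrite -!mulrA.
Qed.

Lemma ext_mul_wedge_mem i K y : i \in K ->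
  ext_mul i (wedge (ext_basis K) y) = 0.
Proof.
move=> iK; apply/ffunP => A; rewrite [LHS]ffunE [RHS]ffunE wedge_basisl.
by rewrite subsetD1 iK andbF mulr0 if_same.
Qed.

(** Disjointness makes every pair of [setX K A] an inversion in exactly one of the two orders. *)
Lemma inversionsD K A : K :&: A = set0 ->
  (inversions K A + inversions A K)%N = (#|K| * #|A|)%N.
Proof.
move=> KA; rewrite -cardsX /inversions.
have -> : #|[set p in setX A K | (p.2 < p.1)%N]| =
          #|[set p : 'I_k * 'I_k in setX K A | (p.1 < p.2)%N]|.
  rewrite -[LHS](card_imset _ (f := fun p : 'I_k * 'I_k => (p.2, p.1))) => [|[a b] [c d]
    [-> ->] //].
  congr #|pred_of_set _|; apply/setP => -[a b]; rewrite !inE /=.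
  apply/imsetP/idP => [[[c d]] | h].
    by rewrite !inE /= => /andP [/andP [cA dK] dc] [-> ->]; rewrite dK cA dc.
  by exists (b, a); rewrite // !inE /= [(b \in A) && _]andbC.
rewrite -(cardsID [set p : 'I_k * 'I_k | (p.2 < p.1)%N] (setX K A)); congr (_ + _)%N.
  by congr #|pred_of_set _|; apply/setP => p; rewrite !inE.
congr #|pred_of_set _|; apply/setP => -[a b]; rewrite !inE /= -leqNgt andbC.
case: (boolP ((a \in K) && (b \in A))); rewrite ?andbF //= => /andP [aK bA].
rewrite !andbT ltn_neqAle; case: eqP => // /val_inj ab.
by move/setP/(_ a): KA; rewrite !inE aK ab bA.
Qed.

(** The spanning family in the definition of the ideal of $d(e_I)$, on which statements about
    relations and co-relations are checked. *)
Definition relation_gen I K1 K2 : ext :=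
  wedge (ext_basis K1) (wedge (ext_d (ext_basis I)) (ext_basis K2)).

Lemma ext_d_basis_neq0 I A : ext_d (ext_basis I) A != 0 ->
  exists2 i, i \in I & A = I :\ i.
Proof.
rewrite ffunE => nz.
have [i] : exists i, (i \notin A) && (i |: A == I).
  apply/existsP; apply: contraR nz => /existsPn h; apply/eqP/big1 => i iA.
  by have := h i; rewrite iA ext_basisE /= => /negPf ->; rewrite mulr0.
by case/andP => iA /eqP <-; exists i; rewrite ?setU11 // setU1K.
Qed.

(** In a nonzero term [K1], [K2] and [I :\ i] are disjoint, so the terms of a generator have a
    common degree and differ only by the element [i] dropped from [I]. *)
Lemma relation_gen_neq0 I K1 K2 A : relation_gen I K1 K2 A != 0 ->
  exists2 i, i \in I & A = (K1 :|: K2) :|: (I :\ i) /\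
    #|A| = (#|K1| + #|K2| + #|I|.-1)%N.
Proof.
rewrite /relation_gen wedge_basisl; case: ifP => [K1A|]; last by rewrite eqxx.
rewrite wedge_basisr; case: ifP => [K2A|]; last by rewrite mulr0 eqxx.
rewrite !mulf_eq0 !signr_eq0 /= => /ext_d_basis_neq0 [i iI e].
exists i => //; rewrite -e; split.
  apply/setP => h; rewrite !inE.
  have [/(subsetP K1A) -> // | h1] := boolP (h \in K1).
  by have [/(subsetP K2A) | h2] := boolP (h \in K2); rewrite ?inE //= h1.
rewrite -(cardsID K1 A) (setIidPr K1A) -(cardsID K2 (A :\: K1)) (setIidPr K2A) e.
by rewrite (cardsD1 i I) iI addnA.
Qed.

(** Graded commutativity, $d(e_I)$ being homogeneous of degree $|I|-1$. It brings the right
    multipliers of the two-sided ideal to the left, where they are iterated [ext_mul]. *)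
Lemma wedge_d_basisC I K : wedge (ext_d (ext_basis I)) (ext_basis K) =
  (-1) ^+ (#|K| * #|I|.-1) *: wedge (ext_basis K) (ext_d (ext_basis I)).
Proof.
apply/ffunP => A; rewrite [RHS]ffunE wedge_basisl wedge_basisr.
case: ifP => KA; last by rewrite scaler0.
have [-> | nz] := eqVneq (ext_d (ext_basis I) (A :\: K)) 0; first by rewrite !mulr0 scaler0.
have [i iI e] := ext_d_basis_neq0 nz.
have := @inversionsD K (A :\: K); rewrite setIDA setDIl setDv set0I => /(_ erefl) c.
have -> : #|I|.-1 = #|A :\: K| by rewrite e (cardsD1 i I) iI.
rewrite -c exprD -[_ *: _]/(_ * _) mulrA; congr (_ * _).
by rewrite mulrAC -expr2 sqrr_sign mul1r.
Qed.

Lemma wedge_basis_ind (P : ext -> Prop) K x :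
  (forall i y, P y -> P (ext_mul i y)) -> (forall a y, P y -> P (a *: y)) ->
  P x -> P (wedge (ext_basis K) x).
Proof.
move=> Pmul Pscale Px; have [r] := ubnP #|K|; elim: r K => // r IH K.
have [-> _ | [i iK] ltKr] := set_0Vmem K; first by rewrite wedge0l.
have iK' : i \notin K :\ i by rewrite setD11.
have := ext_mul_wedge x iK'; rewrite setD1K // => e.
have -> : wedge (ext_basis K) x = ext_sign i (K :\ i) *: ext_mul i (wedge (ext_basis (K :\ i)) x).
  by rewrite e scalerA ext_sign_sqr scale1r.
by apply/Pscale/Pmul/IH; rewrite (cardsD1 i) iK in ltKr.
Qed.

Lemma relation_gen_ind (P : ext -> Prop) I K1 K2 :
  (forall i y, P y -> P (ext_mul i y)) -> (forall a y, P y -> P (a *: y)) ->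
  P (ext_d (ext_basis I)) -> P (relation_gen I K1 K2).
Proof.
move=> Pmul Pscale Px; apply: (wedge_basis_ind (P := P)) => //.
by rewrite wedge_d_basisC; exact: Pscale (wedge_basis_ind _ Pmul Pscale Px).
Qed.

Local Notation ideal I := (ext_ideal (ext_d (ext_basis I))).

Lemma mem_ext_ideal I K1 K2 : relation_gen I K1 K2 \in ideal I.
Proof. by apply: memv_span; apply/imageP; exists (K1, K2). Qed.

Lemma ext_ideal_sub I (X : {vspace ext}) :
  (forall K1 K2, relation_gen I K1 K2 \in X) -> (ideal I <= X)%VS.
Proof. by move=> h; apply/span_subvP => _ /imageP [[K1 K2] _ ->]; apply: h. Qed.

Lemma ext_ideal_mul I i x : x \in ideal I -> ext_mul i x \in ideal I.
Proof.
have h : (ideal I <= linfun (ext_mul i) @^-1: ideal I)%VS.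
  apply: ext_ideal_sub => K1 K2; rewrite -memv_preim lfunE /=.
  have [iK | iK] := boolP (i \in K1); first by rewrite ext_mul_wedge_mem // mem0v.
  by rewrite ext_mul_wedge // memvZ // mem_ext_ideal.
by move/(subvP h); rewrite -memv_preim lfunE.
Qed.

(** Induction on the multipliers, from $d(d(e_I)) = 0$ and $d(e_i y) = y - e_i\,d(y)$; the second
    formula needs $y$ itself in the ideal, hence the conjunction carried along. *)
Lemma ext_ideal_d I x : x \in ideal I -> ext_d x \in ideal I.
Proof.
have h : (ideal I <= linfun (@ext_d k) @^-1: ideal I)%VS.
  apply: ext_ideal_sub => K1 K2; rewrite -memv_preim lfunE /=.
  suff [] : relation_gen I K1 K2 \in ideal I /\ ext_d (relation_gen I K1 K2) \in ideal I by [].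
  apply: (@relation_gen_ind (fun y => y \in ideal I /\ ext_d y \in ideal I)) => [i y [yI
    dyI]|a y [yI dyI]|].
  - split; first exact: ext_ideal_mul.
    by rewrite -[ext_d _](addrK (ext_mul i (ext_d y))) ext_d_mul memvB ?ext_ideal_mul.
  - by rewrite linearZ /= !memvZ.
  - by have := mem_ext_ideal I set0 set0; rewrite /relation_gen wedge0l wedge0r ext_d_sqr0 mem0v.
by move/(subvP h); rewrite -memv_preim lfunE.
Qed.

Lemma ext_d_basis_coef I i : i \in I -> ext_d (ext_basis I) (I :\ i) != 0.
Proof.
move=> iI; rewrite ffunE (bigD1 i) ?setD11 //= ext_basisE setD1K // eqxx mulr1.
rewrite big1 ?addr0 ?signr_eq0 // => h /andP [hI hi]; rewrite ext_basisE.
case: eqP => [e|]; rewrite ?mulr0 //.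
by move: iI; rewrite -e !inE eq_sym (negPf hi) eqxx.
Qed.

(** With $i \in I$ and $K = A \setminus (I \setminus i)$, the product $e_K \wedge d(e_I)$ is a
    nonzero multiple of $e_A$: the terms of $d(e_I)$ that still contain $i$ are killed by $e_K$. *)
Lemma ext_ideal_basis I A : I != set0 -> I \subset A -> ext_basis A \in ideal I.
Proof.
case/set0Pn => i iI IA; pose K := A :\: (I :\ i).
have IiA : I :\ i \subset A by apply: subset_trans IA; apply: subD1set.
have KA : K \subset A by apply: subsetDl.
have AK : A :\: K = I :\ i by rewrite setDDr setDv set0U; apply/setIidPr.
have c : relation_gen I K set0 A != 0.
  rewrite /relation_gen wedge0r wedge_basisl KA AK.
  by rewrite mulf_neq0 ?signr_eq0 // ext_d_basis_coef.
suff -> : ext_basis A = (relation_gen I K set0 A)^-1 *: relation_gen I K set0.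
  by rewrite memvZ // mem_ext_ideal.
apply/ffunP => A'; rewrite ext_basisE [RHS]ffunE; case: eqP => [-> | AA'].
  by rewrite -[_ *: _]/(_ * _) mulVf.
have [-> | nz] := eqVneq (relation_gen I K set0 A') 0; first by rewrite scaler0.
have [j jI [e cA']] := relation_gen_neq0 nz; case: AA'; apply/eqP.
rewrite eqEcard cA' cards0 addn0; apply/andP; split.
  rewrite e setU0 subUset KA; apply: subset_trans IA; exact: subD1set.
have -> : #|I|.-1 = #|I :\ i| by rewrite (cardsD1 i I) iI.
by rewrite -(cardsID (I :\ i) A) (setIidPr IiA) addnC.
Qed.

(** $d(e_i) = 1$ generates the unit ideal. *)
Lemma ext_ideal_set1 i A : ext_basis A \in ideal [set i].
Proof.
have e : ext_d (ext_basis [set i]) = ext_basis set0.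
  apply/ffunP => I; rewrite [RHS]ext_basisE; case: eqP => [-> | I0].
    have := ext_d_basis_coef (set11 i); rewrite setDv ffunE.
    rewrite (bigD1 i) ?inE //= ext_basisE setU0 eqxx mulr1 big1 ?addr0; last first.
      move=> j /andP [_ ji]; rewrite ext_basisE setU0.
      by case: eqP => [/setP/(_ j)|]; rewrite ?mulr0 // !inE eqxx (negPf ji).
    rewrite (_ : [set _ in _ | _] = set0) ?cards0 //.
    by apply/setP => h; rewrite !inE.
  apply/eqP; apply: contra_notT I0 => /ext_d_basis_neq0 [j]; rewrite inE => /eqP -> ->.
  exact: setDv.
by have := mem_ext_ideal [set i] A set0; rewrite /relation_gen wedge0r e wedge0r.
Qed.

End ExteriorOperators.

(** * Flats and circuits *)

Section CommonZeros.
Variables (K : fieldType) (V : vectType K).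
Implicit Types (X : seq 'Hom(V, K^o)) (phi : 'Hom(V, K^o)) (v : V).

Definition common_zeros X : {vspace V} := (\bigcap_(phi <- X) lker phi)%VS.

Lemma common_zeros_cons phi X :
  common_zeros (phi :: X) = (lker phi :&: common_zeros X)%VS.
Proof. exact: big_cons. Qed.

Lemma mem_common_zeros X v :
  reflect (forall phi, phi \in X -> phi v = 0) (v \in common_zeros X).
Proof.
elim: X => [|psi X IH].
  by rewrite /common_zeros big_nil memvf; constructor.
rewrite common_zeros_cons memv_cap memv_ker; apply: (iffP andP) => [[/eqP e /IH h] phi|h].
  by rewrite inE => /orP [/eqP -> //|]; apply: h.
split; first by rewrite h ?mem_head.
by apply/IH => phi phiX; rewrite h // inE phiX orbT.
Qed.

Lemma common_zeros_span X phi v :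
  phi \in <<X>>%VS -> v \in common_zeros X -> phi v = 0.
Proof.
move=> phiX vX; have : (<<X>> <= annih <[v]>)%VS.
  apply/span_subvP => psi psiX; apply/mem_annih => _ /vlineP [a ->].
  by rewrite linearZ /= (mem_common_zeros _ _ vX) // scaler0.
by move/subvP/(_ _ phiX)/mem_annih; apply; apply: memv_line.
Qed.

(** Induction on the family. If [psi] does not vanish at some common zero [v] of [X], subtracting
    from [phi] the multiple of [psi] with the same value at [v] leaves a form vanishing on all
    common zeros of [X]. *)
Lemma span_common_zeros X phi :
  (common_zeros X <= lker phi)%VS -> phi \in <<X>>%VS.
Proof.
elim: X phi => [|psi X IH] phi.
  rewrite /common_zeros big_nil span_nil memv0 => h.
  by apply/eqP/lfunP => v; rewrite lfunE; apply/eqP; rewrite -memv_ker (subvP h) ?memvf.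
rewrite common_zeros_cons span_cons => h.
have [hX | /subvPn [v vX vpsi]] := boolP (common_zeros X <= lker psi)%VS.
  apply: subvP (addvSr _ _) _ _; apply: IH; move/capv_idPr: hX h => -> //.
have {}vpsi : psi v != 0 by rewrite -memv_ker.
pose a := phi v / psi v.
rewrite -(subrK (a *: psi) phi) addrC memv_add ?memvZ ?memv_line //.
apply: IH; apply/subvP => w wX; rewrite memv_ker.
(* The projection of [w] onto the kernel of [psi] along [v]. *)
have : w - (psi w / psi v) *: v \in (lker psi :&: common_zeros X)%VS.
  rewrite memv_cap; apply/andP; split; last by rewrite memvB ?memvZ.
  rewrite memv_ker linearB linearZ /=.
  by rewrite -[_ *: _]/(_ * _) divfK // subrr.
move/(subvP h); rewrite memv_ker linearB linearZ /= subr_eq0 => /eqP e.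
rewrite add_lfunE opp_lfunE scale_lfunE /= e -[_ *: _]/(_ * _) -[a *: _]/(_ * _).
by rewrite /a mulrAC -!mulrA [psi w * _]mulrCA [_ * psi w]mulrC subrr.
Qed.

(** A form outside the span of the others is nonzero on their common zeros, so each form lowers the
    dimension by exactly one. *)
Lemma dim_common_zeros X : free X -> (\dim (common_zeros X) + size X = \dim {:V})%N.
Proof.
elim: X => [_|psi X IH]; first by rewrite /common_zeros big_nil addn0.
rewrite free_cons common_zeros_cons => /andP [psiX /IH <-] /=.
have /subvPn [v vX vpsi] : ~~ (common_zeros X <= lker psi)%VS.
  by apply: contra psiX; apply: span_common_zeros.
have := limg_ker_dim psi (common_zeros X); rewrite capvC => <-.
suff -> : \dim (psi @: common_zeros X) = 1%N by rewrite addn1 addnS addSn.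
apply/eqP; rewrite eqn_leq; apply/andP; split.
  by have := dimvS (subvf (psi @: common_zeros X)); rewrite dimvf.
rewrite lt0n dimv_eq0; apply: contraNneq vpsi => e.
by rewrite memv_ker -memv0 -e memv_img.
Qed.

End CommonZeros.

(** * Flats of the two arrangements and their circuits *)

Section Flats.
Local Notation form := Defs.form.
Variables (K : fieldType) (n l m : nat).
Local Notation V := 'rV[K]_n.
Variables (L : 'I_l -> {vspace V}) (M : 'I_m -> {vspace V}).
Hypothesis dimL : forall i, (\dim (L i)).+1 = n.
Hypothesis dimM : forall j, (\dim (M j)).+1 = n.
Local Notation flat := (flat L M).
Local Notation dependent := (dependent L M).
Local Notation circuit := (circuit L M).
Implicit Types (I : {set 'I_l}) (J : {set 'I_m}).

Definition flat_forms I J : seq 'Hom(V, K^o) :=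
  [seq form (L i) | i <- enum I] ++ [seq form (M j) | j <- enum J].

Lemma subv_flatP (S : {vspace V}) I J :
  reflect ((forall i, i \in I -> (S <= L i)%VS) /\ (forall j, j \in J -> (S <= M j)%VS))
    (S <= flat I J)%VS.
Proof.
rewrite subv_cap; apply: (iffP andP) => [[/subv_bigcapP h1 /subv_bigcapP h2] | [h1 h2]].
  by split.
by split; apply/subv_bigcapP.
Qed.

Lemma flat_subL I J i : i \in I -> (flat I J <= L i)%VS.
Proof. by have /subv_flatP [h _] := subvv (flat I J); apply: h. Qed.

Lemma flat_subM I J j : j \in J -> (flat I J <= M j)%VS.
Proof. by have /subv_flatP [_ h] := subvv (flat I J); apply: h. Qed.

Lemma flatS I J I' J' : I \subset I' -> J \subset J' -> (flat I' J' <= flat I J)%VS.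
Proof.
move=> /subsetP II' /subsetP JJ'; apply/subv_flatP; split=> [i /II'|j /JJ'].
  exact: flat_subL.
exact: flat_subM.
Qed.

Lemma flatU I J I' J' : flat (I :|: I') (J :|: J') = (flat I J :&: flat I' J')%VS.
Proof.
apply/eqP; rewrite eqEsubv; apply/andP; split.
  by rewrite subv_cap !flatS ?subsetUl ?subsetUr.
apply/subv_flatP; split=> [i|j]; rewrite inE => /orP [h|h].
- exact: subv_trans (capvSl _ _) (flat_subL _ h).
- exact: subv_trans (capvSr _ _) (flat_subL _ h).
- exact: subv_trans (capvSl _ _) (flat_subM _ h).
- exact: subv_trans (capvSr _ _) (flat_subM _ h).
Qed.

Lemma flat_common_zeros I J : flat I J = common_zeros (flat_forms I J).
Proof.
have kL i v : (v \in L i) = (form (L i) v == 0) by rewrite -memv_ker lker_form.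
have kM j v : (v \in M j) = (form (M j) v == 0) by rewrite -memv_ker lker_form.
apply/vspaceP => v; apply/idP/mem_common_zeros => [vF phi | h].
  rewrite mem_cat => /orP [] /mapP [i]; rewrite mem_enum => h ->; apply/eqP.
    by rewrite -kL (subvP (flat_subL J h) _ vF).
  by rewrite -kM (subvP (flat_subM I h) _ vF).
rewrite memvE; apply/subv_flatP; split=> i iI; rewrite -memvE ?kL ?kM; apply/eqP/h;
  rewrite mem_cat; apply/orP; [left | right]; by apply/map_f; rewrite mem_enum.
Qed.

Lemma flat_formsU1L i I J : i \notin I ->
  perm_eq (flat_forms (i |: I) J) (form (L i) :: flat_forms I J).
Proof.
move=> iI; rewrite -cat_cons perm_cat2r -[_ :: _]/(map _ (i :: enum I)).
apply: perm_map; apply: uniq_perm; rewrite /= ?enum_uniq ?mem_enum ?iI //.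
by move=> h; rewrite mem_enum !inE mem_enum.
Qed.

Lemma flat_formsU1M j I J : j \notin J ->
  perm_eq (flat_forms I (j |: J)) (form (M j) :: flat_forms I J).
Proof.
move=> jJ; rewrite -cat1s perm_sym perm_catCA perm_cat2l.
rewrite cat1s -[_ :: _]/(map _ (j :: enum J)).
apply: perm_map; apply: uniq_perm; rewrite /= ?enum_uniq ?mem_enum ?jJ //.
by move=> h; rewrite mem_enum !inE mem_enum.
Qed.

Lemma circuit_dependent I J : circuit I J -> dependent I J.
Proof. by case/andP. Qed.

Lemma circuit_minimal I J I' J' : circuit I J -> I' \subset I -> J' \subset J ->
  dependent I' J' -> I' = I /\ J' = J.
Proof.
case/andP => _ /forallP/(_ I')/forallP/(_ J')/implyP h II JJ D.
by move: h; rewrite II JJ D => /(_ isT) /andP [/eqP -> /eqP ->].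
Qed.

Lemma exists_circuit I J : dependent I J ->
  exists I' J', [/\ I' \subset I, J' \subset J & circuit I' J'].
Proof.
have [r] := ubnP (#|I| + #|J|); elim: r I J => // r IH I J ltr D.
have [C | ] := boolP (circuit I J); first by exists I, J.
rewrite /circuit D /= => /forallPn [I'] /forallPn [J'].
rewrite negb_imply => /andP [/and3P [II JJ D'] ne].
have [|I'' [J'' [h1 h2 h3]]] := IH I' J' _ D'; last first.
  by exists I'', J''; split=> //; [apply: subset_trans h1 II | apply: subset_trans h2 JJ].
rewrite -ltnS; apply: leq_trans ltr; rewrite ltnS ltnNge; apply: contra ne => le.
rewrite !eqEcard II JJ /=.
have lI := subset_leq_card II; have lJ := subset_leq_card JJ.
apply/andP; split.
  by rewrite -(leq_add2r #|J'|) (leq_trans _ le) // leq_add2l.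
by rewrite -(leq_add2l #|I'|) (leq_trans _ le) // leq_add2r.
Qed.

(** By minimality the forms left after removing [i] are independent, so the dependence of the
    circuit puts the form of [L i] in their span. *)
Lemma circuit_flatD1L I J i : circuit I J -> i \in I -> flat (I :\ i) J = flat I J.
Proof.
move=> C iI; apply/eqP; rewrite eqEsubv; apply/andP; split; last by rewrite flatS ?subD1set.
apply/subv_flatP; split=> [h hI | j]; last exact: flat_subM.
have [-> | hi] := eqVneq h i; last by apply: flat_subL; rewrite !inE hi.
have F : free (flat_forms (I :\ i) J).
  apply: contraLR iI => D; have [<- _] := circuit_minimal C (subD1set _ _) (subxx _) D.
  by rewrite setD11.
have := circuit_dependent C; rewrite /Defs.dependent -/(flat_forms I J) -{1}(setD1K iI).
rewrite (perm_free (flat_formsU1L _ _)) ?setD11 // free_cons F andbT negbK => fF.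
apply/subvP => v; rewrite flat_common_zeros -(lker_form (dimL i)) memv_ker => vF.
by rewrite (common_zeros_span fF vF).
Qed.

Lemma circuit_flatD1M I J j : circuit I J -> j \in J -> flat I (J :\ j) = flat I J.
Proof.
move=> C jJ; apply/eqP; rewrite eqEsubv; apply/andP; split; last by rewrite flatS ?subD1set.
apply/subv_flatP; split=> [i | h hJ]; first exact: flat_subL.
have [-> | hj] := eqVneq h j; last by apply: flat_subM; rewrite !inE hj.
have F : free (flat_forms I (J :\ j)).
  apply: contraLR jJ => D; have [_ <-] := circuit_minimal C (subxx _) (subD1set _ _) D.
  by rewrite setD11.
have := circuit_dependent C; rewrite /Defs.dependent -/(flat_forms I J) -{1}(setD1K jJ).
rewrite (perm_free (flat_formsU1M _ _)) ?setD11 // free_cons F andbT negbK => fF.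
apply/subvP => v; rewrite flat_common_zeros -(lker_form (dimM j)) memv_ker => vF.
by rewrite (common_zeros_span fF vF).
Qed.

(** A form vanishing on the flat lies in the span of the forms that define it. This produces
    dependent pairs, hence circuits, from inclusions. *)
Lemma dependent_subL I J i : i \notin I -> (flat I J <= L i)%VS -> dependent (i |: I) J.
Proof.
move=> iI FL; rewrite /Defs.dependent -/(flat_forms _ _) (perm_free (flat_formsU1L _ _)) //.
by rewrite free_cons span_common_zeros // -flat_common_zeros lker_form.
Qed.

Lemma dependent_subM I J j : j \notin J -> (flat I J <= M j)%VS -> dependent I (j |: J).
Proof.
move=> jJ FM; rewrite /Defs.dependent -/(flat_forms _ _) (perm_free (flat_formsU1M _ _)) //.
by rewrite free_cons span_common_zeros // -flat_common_zeros lker_form.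
Qed.

Lemma independent_codim I J : ~~ dependent I J ->
  codim (flat_stratum L M I J) = (#|I| + #|J|)%N.
Proof.
rewrite negbK => /dim_common_zeros; rewrite -flat_common_zeros size_cat !size_map -!cardE.
rewrite [\dim {:V}]dimvf /dim /= mul1n => e.
by rewrite /codim /stratum_space /= -[X in (X - _)%N]e addKn.
Qed.

Lemma form_neq0 (H : {vspace V}) : (\dim H).+1 = n -> form H != 0.
Proof.
move=> dH; apply/eqP => e; have := lker_form dH; rewrite e => h.
have : lker (0 : 'Hom(V, K^o)) = fullv.
  by apply/vspaceP => v; rewrite memv_ker lfunE /= eqxx memvf.
rewrite h => eH; move: dH; rewrite eH dimvf /dim /= mul1n => /esym/eqP.
by rewrite (ltn_eqF (ltnSn n)).
Qed.

Lemma dependent_set1L i : ~~ dependent [set i] set0.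
Proof.
rewrite negbK /Defs.dependent enum_set1 enum_set0 /= /free /= span_seq1 dim_vline.
by rewrite form_neq0.
Qed.

Lemma dependent_set1M j : ~~ dependent set0 [set j].
Proof.
rewrite negbK /Defs.dependent enum_set1 enum_set0 /= /free /= span_seq1 dim_vline.
by rewrite form_neq0.
Qed.

Lemma dependent_set0 : ~~ dependent set0 set0.
Proof. by rewrite negbK !enum_set0 nil_free. Qed.

End Flats.

(** * Relations and co-relations *)

Lemma ext_mul_basis k (j : 'I_k) (J : {set 'I_k}) : ext_mul j (ext_basis J) =
  if j \in J then 0 else ext_sign j J *: ext_basis (j |: J).
Proof.
have := ext_mul_wedge_mem (ext_basis set0) (K := J) (i := j).
have := ext_mul_wedge (ext_basis set0) (K := J) (i := j).
by rewrite !wedge0r; case: ifP => [_ _ -> | _ ->].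
Qed.

Lemma ext_contract_basis k (j : 'I_k) (J : {set 'I_k}) : ext_contract j (ext_basis J) =
  if j \in J then ext_sign j J *: ext_basis (J :\ j) else 0.
Proof.
have := ext_contract_mul j j (ext_basis (J :\ j)).
rewrite ext_mul_basis setD11 eqxx scale1r linearZ /=.
case: ifPn => jJ; last first.
  move=> _; apply/ffunP => I; rewrite !ffunE; case: ifP => // jI.
  by rewrite (_ : _ == J = false) ?mulr0 //; apply: contraNF jJ => /eqP <-; apply: setU11.
have z : ext_contract j (ext_basis (J :\ j)) = 0.
  apply/ffunP => I; rewrite !ffunE; case: ifP => // jI.
  by case: eqP => [/setP/(_ j)|]; rewrite ?mulr0 // !inE eqxx.
rewrite z linear0 addr0 setD1K // => e.
by rewrite -{}e ext_signD1 // ltnn mul1r scalerA ext_sign_sqr scale1r.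
Qed.

(** * Operators on the tensor product and coordinate truncations *)

Section TensorOperators.
Variables l m : nat.
Local Notation extl := {ffun {set 'I_l} -> rat^o}.
Local Notation extm := {ffun {set 'I_m} -> rat^o}.
Local Notation E := {ffun {set 'I_l} * {set 'I_m} -> rat^o}.
Implicit Types (u : E) (I : {set 'I_l}) (J : {set 'I_m}).

(** An operator on one tensor factor acts slice by slice, so identities of the exterior algebra
    transfer to [E] by comparing slices. *)
Definition slice1 J u : extl := [ffun I => u (I, J)].
Definition slice2 I u : extm := [ffun J => u (I, J)].
Definition lift1 (f : extl -> extl) u : E := [ffun p => f (slice1 p.2 u) p.1].
Definition lift2 (f : extm -> extm) u : E := [ffun p => f (slice2 p.1 u) p.2].

Fact slice1_linear J : linear (slice1 J).
Proof. by move=> a u v; apply/ffunP => I; rewrite !ffunE. Qed.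
HB.instance Definition _ J := GRing.isLinear.Build _ _ _ _ (slice1 J) (slice1_linear J).

Fact slice2_linear I : linear (slice2 I).
Proof. by move=> a u v; apply/ffunP => J; rewrite !ffunE. Qed.
HB.instance Definition _ I := GRing.isLinear.Build _ _ _ _ (slice2 I) (slice2_linear I).

Fact lift1_linear (f : {linear extl -> extl}) : linear (lift1 f).
Proof. by move=> a u v; apply/ffunP => p; rewrite ffunE !linearP !ffunE. Qed.
HB.instance Definition _ f := GRing.isLinear.Build _ _ _ _ (lift1 _) (lift1_linear f).

Fact lift2_linear (f : {linear extm -> extm}) : linear (lift2 f).
Proof. by move=> a u v; apply/ffunP => p; rewrite ffunE !linearP !ffunE. Qed.
HB.instance Definition _ f := GRing.isLinear.Build _ _ _ _ (lift2 _) (lift2_linear f).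

Lemma slice_lift1 f J u : slice1 J (lift1 f u) = f (slice1 J u).
Proof. by apply/ffunP => I; rewrite !ffunE. Qed.

Lemma slice_lift2 f I u : slice2 I (lift2 f u) = f (slice2 I u).
Proof. by apply/ffunP => J; rewrite !ffunE. Qed.

Lemma slice1_inj u v : (forall J, slice1 J u = slice1 J v) -> u = v.
Proof. by move=> h; apply/ffunP => -[I J]; have /ffunP/(_ I) := h J; rewrite !ffunE. Qed.

Lemma slice2_inj u v : (forall I, slice2 I u = slice2 I v) -> u = v.
Proof. by move=> h; apply/ffunP => -[I J]; have /ffunP/(_ J) := h I; rewrite !ffunE. Qed.

Lemma lift1_tensor (f : {linear extl -> extl}) x y :
  lift1 f (tensor x y) = tensor (f x) y.
Proof.
apply: slice1_inj => J; rewrite slice_lift1.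
have e z : slice1 J (tensor z y) = y J *: z.
  by apply/ffunP => I; rewrite !ffunE /= mulrC.
by rewrite !e linearZ.
Qed.

Lemma lift2_tensor (f : {linear extm -> extm}) x y :
  lift2 f (tensor x y) = tensor x (f y).
Proof.
apply: slice2_inj => I; rewrite slice_lift2.
have e z : slice2 I (tensor x z) = x I *: z by apply/ffunP => J; rewrite !ffunE.
by rewrite !e linearZ.
Qed.

Lemma tensor_d1E u : tensor_d1 u = lift1 (@ext_d l) u. Proof. by []. Qed.

Lemma tensor_d2E u : tensor_d2 u = lift2 (@ext_d_dual m) u. Proof. by []. Qed.

Lemma tensor_d1_sqr0 u : tensor_d1 (tensor_d1 u) = 0.
Proof. by apply: slice1_inj => J; rewrite !tensor_d1E !slice_lift1 ext_d_sqr0 linear0. Qed.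

Lemma tensor_d2_sqr0 u : tensor_d2 (tensor_d2 u) = 0.
Proof. by apply: slice2_inj => I; rewrite !tensor_d2E !slice_lift2 ext_d_dual_sqr0 linear0. Qed.

Lemma tensor_d1_coef u I J :
  tensor_d1 u (I, J) = \sum_(i | i \notin I) ext_sign i I * u (i |: I, J).
Proof. by rewrite !ffunE; apply: eq_bigr => i _; rewrite ffunE. Qed.

Lemma tensor_d2_coef u I J :
  tensor_d2 u (I, J) = \sum_(j in J) ext_sign j J * u (I, J :\ j).
Proof.
rewrite tensor_d2E ffunE ext_d_dualE sum_ffunE [RHS]big_mkcond.
by apply: eq_bigr => j _; rewrite !ffunE.
Qed.

Lemma tensor_d1_d2 u : tensor_d1 (tensor_d2 u) = tensor_d2 (tensor_d1 u).
Proof.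
apply/ffunP => -[I J]; rewrite tensor_d1_coef tensor_d2_coef.
under eq_bigr => i _ do rewrite tensor_d2_coef mulr_sumr.
under [RHS]eq_bigr => j _ do rewrite tensor_d1_coef mulr_sumr.
by rewrite exchange_big; do 2!apply: eq_bigr => ? _; rewrite mulrCA.
Qed.

Lemma tensor_d1_mul i u :
  tensor_d1 (lift1 (ext_mul i) u) + lift1 (ext_mul i) (tensor_d1 u) = u.
Proof.
by apply: slice1_inj => J; rewrite !tensor_d1E linearD /= !slice_lift1 ext_d_mul.
Qed.

Lemma tensor_d2_contract j u :
  tensor_d2 (lift2 (ext_contract j) u) + lift2 (ext_contract j) (tensor_d2 u) = u.
Proof.
by apply: slice2_inj => I; rewrite !tensor_d2E linearD /= !slice_lift2 ext_d_dual_contract.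
Qed.

Lemma tensor0l y : tensor 0 y = 0 :> E.
Proof. by apply/ffunP => p; rewrite !ffunE mul0r. Qed.

Lemma tensor0r x : tensor x 0 = 0 :> E.
Proof. by apply/ffunP => p; rewrite !ffunE mulr0. Qed.

Lemma tensorZr a x y : tensor x (a *: y) = a *: tensor x y :> E.
Proof. by apply/ffunP => p; rewrite !ffunE -[LHS]/(_ * (_ * _)) mulrCA. Qed.

Lemma tensor_basisE I J p : tensor (ext_basis I) (ext_basis J) p = (p == (I, J))%:R.
Proof. by case: p => A A'; rewrite ffunE !ext_basisE xpair_eqE -natrM mulnb. Qed.

Lemma tensor_basis_sum u :
  u = \sum_p u p *: tensor (ext_basis p.1) (ext_basis p.2).
Proof.
apply/ffunP => q; rewrite sum_ffunE (bigD1 q) //= ffunE tensor_basisE -surjective_pairing eqxx.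
rewrite -[_ *: _]/(_ * _) mulr1 big1 ?addr0 // => p /negPf pq.
by rewrite ffunE tensor_basisE -surjective_pairing eq_sym pq scaler0.
Qed.

Definition restr (Q : pred ({set 'I_l} * {set 'I_m})) u : E :=
  [ffun p => if Q p then u p else 0].

Lemma restrE Q u p : restr Q u p = if Q p then u p else 0.
Proof. exact: ffunE. Qed.

Fact restr_linear Q : linear (restr Q).
Proof. by move=> a u v; apply/ffunP => p; rewrite !ffunE; case: ifP;
  rewrite // scaler0 addr0. Qed.
HB.instance Definition _ Q := GRing.isLinear.Build _ _ _ _ (restr Q) (restr_linear Q).

Lemma restr_id (Q : pred ({set 'I_l} * {set 'I_m})) u : (forall p, u p != 0 -> Q p) ->
  restr Q u = u.
Proof.
move=> h; apply/ffunP => p; rewrite ffunE; case: ifPn => // Qp.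
by apply/esym/eqP; apply: contraNT Qp; apply: h.
Qed.

Lemma mem_basis_span (Q : pred ({set 'I_l} * {set 'I_m})) u :
  reflect (forall p, u p != 0 -> Q p) (u \in basis_span Q).
Proof.
apply: (iffP idP) => [uQ p | h]; last first.
  rewrite (tensor_basis_sum u) rpred_sum // => p _.
  have [-> | /h Qp] := eqVneq (u p) 0; first by rewrite scale0r mem0v.
  by rewrite memvZ // memv_span //; apply/imageP; exists p.
apply: contraR => Qp; pose f (v : E) : rat^o := v p.
have fl : linear f by move=> a v w; rewrite /f !ffunE.
pose F : {linear E -> rat^o} := HB.pack f (GRing.isLinear.Build _ _ _ _ f fl).
have : (basis_span Q <= lker (linfun F))%VS.
  apply/span_subvP => _ /imageP [q Qq ->]; rewrite memv_ker lfunE /= /f tensor_basisE.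
  rewrite -surjective_pairing; have [e | _] := eqVneq p q; last by rewrite eqxx.
  by move: Qq; rewrite unfold_in /= -e (negPf Qp).
by move/subvP/(_ u uQ); rewrite memv_ker lfunE.
Qed.

End TensorOperators.

(** * Stability of the relations and of the annihilator of the co-relations *)

Section Relations.
Variables (K : fieldType) (n l m : nat) (B : biarrangement K n l m).
Local Notation E := {ffun {set 'I_l} * {set 'I_m} -> rat^o}.
Local Notation L := (bi_L B).
Local Notation M := (bi_M B).
Local Notation flat := (flat L M).
Local Notation flat_stratum := (flat_stratum L M).
Local Notation circuit := (circuit L M).
Local Notation chi := (bi_chi B).
Local Notation U := (corelations_perp B).
Local Notation W := (relations B).
Local Notation ideal I := (ext_ideal (ext_d (ext_basis I))).
Implicit Types (u : E) (I : {set 'I_l}) (J : {set 'I_m}).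

Lemma mem_relations I J J' y : circuit I J -> chi (flat_stratum I J) = Lambda ->
  J \subset J' -> y \in ideal I -> tensor y (ext_basis J') \in W.
Proof.
move=> C c JJ' yI; rewrite /relations.
apply: (subvP (sumv_sup (I, J) _ (subvv _))) => /=; first by rewrite C c eqxx.
apply: (subvP (sumv_sup J' _ (subvv _))) => //=.
by apply/memv_imgP; exists y => //; rewrite lfunE.
Qed.

Lemma relations_sub (X : {vspace E}) :
  (forall I J J' K1 K2, circuit I J -> chi (flat_stratum I J) = Lambda ->
     J \subset J' -> tensor (relation_gen I K1 K2) (ext_basis J') \in X) ->
  (W <= X)%VS.
Proof.
move=> h; apply/subv_sumP => -[I J] /= /andP [C /eqP c]; apply/subv_sumP => J' JJ'.
apply/subvP => _ /memv_imgP [y yI ->].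
have : (ideal I <= linfun (tensor_dual_basis J') @^-1: X)%VS.
  by apply: ext_ideal_sub => K1 K2; rewrite -memv_preim lfunE /=; apply: h C c JJ'.
by move/subvP/(_ _ yI); rewrite -memv_preim.
Qed.

Lemma relations_stable (f : {linear E -> E}) :
  (forall I J J' K1 K2, circuit I J -> chi (flat_stratum I J) = Lambda ->
     J \subset J' -> f (tensor (relation_gen I K1 K2) (ext_basis J')) \in W) ->
  forall w, w \in W -> f w \in W.
Proof.
move=> h w; have : (W <= linfun f @^-1: W)%VS.
  by apply: relations_sub => *; rewrite -memv_preim lfunE; eauto.
by move/subvP/(_ w) => {}h /h; rewrite -memv_preim lfunE.
Qed.

Lemma corelations_perp0 I J I' y u : circuit I J -> chi (flat_stratum I J) = Mu ->
  I \subset I' -> y \in ideal J -> u \in U -> \sum_A y A * u (I', A) = 0.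
Proof.
move=> C c II' yJ /mem_coannih /(_ (cotensor I' y)); rewrite lfunE; apply.
apply: (subvP (sumv_sup (I, J) _ (subvv _))) => /=; first by rewrite C c eqxx.
apply: (subvP (sumv_sup I' _ (subvv _))) => //=.
by apply/memv_imgP; exists y => //; rewrite lfunE.
Qed.

Lemma mem_corelations_perp u :
  (forall I J I' K1 K2, circuit I J -> chi (flat_stratum I J) = Mu -> I \subset I' ->
     \sum_A relation_gen J K1 K2 A * u (I', A) = 0) ->
  u \in U.
Proof.
move=> h; apply/mem_coannih => phi phiC.
have : (corelations B <= annih <[u]>)%VS.
  apply/subv_sumP => -[I J] /= /andP [C /eqP c]; apply/subv_sumP => I' II'.
  apply/subvP => _ /memv_imgP [y yJ ->].
  have : (ideal J <= linfun (cotensor I') @^-1: annih <[u]>)%VS.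
    apply: ext_ideal_sub => K1 K2; rewrite -memv_preim; apply/mem_annih => _ /vlineP [a ->].
    by rewrite linearZ /= !lfunE /= /cotensor_fun (h I J) // scaler0.
  by move/subvP/(_ _ yJ); rewrite -memv_preim.
by move/subvP/(_ _ phiC)/mem_annih; apply; apply: memv_line.
Qed.

(** As [J'] contains [J], the dropped element [i] is still forced by the rest of the circuit, so the
    flat of a term does not remember which element was dropped. *)
Lemma relation_genL_flat I J J' K1 K2 A : circuit I J -> J \subset J' ->
  relation_gen I K1 K2 A != 0 ->
  #|A| = (#|K1| + #|K2| + #|I|.-1)%N /\ flat A J' = flat (K1 :|: K2 :|: I) J'.
Proof.
move=> C JJ' /relation_gen_neq0 [i iI [-> ->]]; split=> //.
have <- : J' :|: J = J' by apply/setUidPl.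
by rewrite !flatU (circuit_flatD1L (@bi_dim_L _ _ _ _ B) (@bi_dim_M _ _ _ _ B) C).
Qed.

Lemma relation_genM_flat I J I' K1 K2 A : circuit I J -> I \subset I' ->
  relation_gen J K1 K2 A != 0 ->
  #|A| = (#|K1| + #|K2| + #|J|.-1)%N /\ flat I' A = flat I' (K1 :|: K2 :|: J).
Proof.
move=> C II' /relation_gen_neq0 [j jJ [-> ->]]; split=> //.
have <- : I' :|: I = I' by apply/setUidPl.
by rewrite !flatU (circuit_flatD1M (@bi_dim_L _ _ _ _ B) (@bi_dim_M _ _ _ _ B) C).
Qed.

(** Such a predicate is constant on the support of every generator of $R$ and of $C$; this is what
    makes [restr Q] compatible with both. *)
Definition homogeneous (Q : pred ({set 'I_l} * {set 'I_m})) :=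
  forall I J I' J', #|I| = #|I'| -> #|J| = #|J'| -> flat I J = flat I' J' ->
    Q (I, J) = Q (I', J').

Lemma restr_relation_gen Q I J J' K1 K2 : homogeneous Q -> circuit I J -> J \subset J' ->
  let t := tensor (relation_gen I K1 K2) (ext_basis J') in
  restr Q t = 0 \/ restr Q t = t /\ forall p, t p != 0 -> Q p.
Proof.
move=> hQ C JJ' t.
have tE A A' : t (A, A') != 0 -> A' = J' /\ relation_gen I K1 K2 A != 0.
  rewrite /t ffunE /= ext_basisE; have [-> | _] := eqVneq A' J'; last by rewrite mulr0 eqxx.
  by rewrite mulr1.
have [/existsP [[A A'] /andP [nz QA]] | none] := boolP [exists p, (t p != 0) && Q p].
  have h p : t p != 0 -> Q p.
    case: p => D D' /tE [-> /(relation_genL_flat C JJ') [e1 e2]].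
    have [eA' /(relation_genL_flat C JJ') [f1 f2]] := tE _ _ nz.
    by rewrite (_ : Q (D, J') = Q (A, A')) // eA'; apply: hQ; rewrite ?e1 ?e2 ?f1 ?f2.
  by right; split=> //; apply: restr_id.
left; apply/ffunP => p; rewrite [LHS]ffunE [RHS]ffunE; case: ifP => // Qp; apply/eqP.
by move/existsPn/(_ p): none; rewrite Qp andbT negbK.
Qed.

Lemma restr_relations Q w : homogeneous Q -> w \in W -> restr Q w \in W.
Proof.
move=> hQ; apply: relations_stable => I J J' K1 K2 C c JJ' /=.
have [-> | [-> _]] := restr_relation_gen K1 K2 hQ C JJ'; first exact: mem0v.
exact: mem_relations C c JJ' (mem_ext_ideal _ _ _).
Qed.

(** The support of a co-relation lies entirely inside [Q] or entirely outside, so its pairing with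
    [restr Q u] is its pairing with [u] or 0. *)
Lemma restr_corelations_perp Q u : homogeneous Q -> u \in U -> restr Q u \in U.
Proof.
move=> hQ uU; apply: mem_corelations_perp => I J I' K1 K2 C c II'.
have [/existsP [A /andP [nz QA]] | none] :=
  boolP [exists A, (relation_gen J K1 K2 A != 0) && Q (I', A)].
  rewrite -[RHS](corelations_perp0 C c II' (mem_ext_ideal _ K1 K2) uU).
  apply: eq_bigr => D _; rewrite restrE.
  have [-> | nzD] := eqVneq (relation_gen J K1 K2 D) 0; first by rewrite !mul0r.
  have [e1 e2] := relation_genM_flat C II' nz.
  have [f1 f2] := relation_genM_flat C II' nzD.
  by rewrite (hQ _ _ I' A) ?QA ?e1 ?f1 ?e2 ?f2.
rewrite big1 // => D _; rewrite restrE; case: ifP => QD; rewrite ?mulr0 //.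
by move/existsPn/(_ D): none; rewrite QD andbT negbK => /eqP ->; rewrite mul0r.
Qed.

Lemma tensor_d1_relations w : w \in W -> tensor_d1 w \in W.
Proof.
apply: relations_stable => I J J' K1 K2 C c JJ' /=.
by rewrite tensor_d1E lift1_tensor; apply: mem_relations C c JJ' (ext_ideal_d
  (mem_ext_ideal _ _ _)).
Qed.

(** $d''$ only enlarges the second index, and relations are imposed for every $J' \supset J$. *)
Lemma tensor_d2_relations w : w \in W -> tensor_d2 w \in W.
Proof.
apply: relations_stable => I J J' K1 K2 C c JJ' /=.
rewrite tensor_d2E lift2_tensor /= ext_d_dualE.
rewrite (_ : tensor _ _ = \sum_j tensor (relation_gen I K1 K2) (ext_mul j (ext_basis J')));
  last first.
  apply/ffunP => p; rewrite sum_ffunE [LHS]ffunE sum_ffunE mulr_sumr.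
  by apply: eq_bigr => j _; rewrite [RHS]ffunE.
apply: rpred_sum => j _; rewrite ext_mul_basis; case: ifP => _.
  by rewrite tensor0r mem0v.
rewrite tensorZr; apply/memvZ/(mem_relations C c _ (mem_ext_ideal _ _ _)).
exact: subset_trans JJ' (subsetUr _ _).
Qed.

(** Transposed, $d'$ enlarges the index $I'$ of a co-relation, and co-relations are imposed for
    every $I' \supset I$. *)
Lemma tensor_d1_corelations_perp u : u \in U -> tensor_d1 u \in U.
Proof.
move=> uU; apply: mem_corelations_perp => I J I' K1 K2 C c II'.
under eq_bigr => A _ do rewrite tensor_d1_coef mulr_sumr.
rewrite exchange_big big1 //= => i iI'.
under eq_bigr => A _ do rewrite mulrCA.
rewrite -mulr_sumr (corelations_perp0 C c _ (mem_ext_ideal _ _ _) uU) ?mulr0 //.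
exact: subset_trans II' (subsetUr _ _).
Qed.

(** Here the transpose of $d''$ is $d$ on the second factor, which preserves the ideal of
    $d(f_J)$. *)
Lemma tensor_d2_corelations_perp u : u \in U -> tensor_d2 u \in U.
Proof.
move=> uU; apply: mem_corelations_perp => I J I' K1 K2 C c II'.
rewrite -[RHS](corelations_perp0 C c II' (ext_ideal_d (mem_ext_ideal _ K1 K2)) uU).
under [RHS]eq_bigr => A _ do rewrite -[u (I', A)](ffunE (fun A => u (I', A))).
by rewrite ext_d_transpose; apply: eq_bigr => A _; congr (_ * _); exact: ffunE.
Qed.

Lemma lift_mul_relations i w : w \in W -> lift1 (ext_mul i) w \in W.
Proof.
apply: relations_stable => I J J' K1 K2 C c JJ' /=.
by rewrite lift1_tensor; apply: mem_relations C c JJ' (ext_ideal_mul _ (mem_ext_ideal _ _ _)).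
Qed.

Lemma lift_contract_corelations_perp j u : u \in U -> lift2 (ext_contract j) u \in U.
Proof.
move=> uU; apply: mem_corelations_perp => I J I' K1 K2 C c II'.
rewrite -[RHS](corelations_perp0 C c II' (ext_ideal_mul j (mem_ext_ideal _ K1 K2)) uU).
under [RHS]eq_bigr => A _ do rewrite -[u (I', A)](ffunE (fun A => u (I', A))).
by rewrite ext_mul_transpose; apply: eq_bigr => A _; congr (_ * _); exact: ffunE.
Qed.

Definition supported_above (S : {vspace 'rV[K]_n}) u :=
  forall I J, u (I, J) != 0 -> (S <= flat I J)%VS.

(** Pairing $e_i u$ with a co-relation at [I'] reads [u] at [I' :\ i]. If [i] is not in the circuit,
    this is again a co-relation, at [I' :\ i]. If it is, a nonzero term would place [S] below the
    flat of a circuit of colour mu through [i], which the hypothesis excludes. *)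
Lemma lift_mul_corelations_perp (S : {vspace 'rV[K]_n}) i u :
  (S <= L i)%VS ->
  (forall I J, circuit I J -> i \in I -> (S <= flat I J)%VS -> chi (flat_stratum I J) <> Mu) ->
  supported_above S u -> u \in U -> lift1 (ext_mul i) u \in U.
Proof.
move=> Si tm su uU; apply: mem_corelations_perp => I J I' K1 K2 C c II'.
have e A : lift1 (ext_mul i) u (I', A) = if i \in I' then ext_sign i I' * u (I' :\ i, A) else 0.
  by rewrite !ffunE.
have [iI' | iI'] := boolP (i \in I'); last first.
  by rewrite big1 // => A _; rewrite e (negPf iI') mulr0.
under eq_bigr => A _ do rewrite e iI'.
under eq_bigr => A _ do rewrite mulrCA.
rewrite -mulr_sumr; have [iI | iI] := boolP (i \in I); last first.
  rewrite (corelations_perp0 C c _ (mem_ext_ideal _ _ _) uU) ?mulr0 //.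
  by rewrite subsetD1 II'.
rewrite big1 ?mulr0 // => A _; apply/eqP; rewrite mulf_eq0 -[_ || _]negbK negb_or.
apply/negP => /andP [nz /su SI']; case: (tm I J) => //.
(* The support of [u] gives the inclusion without [i]; [S <= L i] restores it. *)
have : (S <= flat I' A)%VS.
  apply/subv_flatP; split=> [h hI' | j jA]; last exact: subv_trans SI' (flat_subM _ _ _ jA).
  have [-> // | hi] := eqVneq h i.
  by apply: subv_trans SI' (flat_subL _ _ _ _); rewrite !inE hi.
have [_ ->] := relation_genM_flat C II' nz => h.
by apply: subv_trans h (flatS _ _ _ _); rewrite ?subsetUr.
Qed.

(** Contraction removes [j] from [J']. This is harmless when [j] is outside [J]; when [j] is in [J],
    the hypothesis excludes the generators lying above [S]. *)
Lemma lift_contract_relations (S : {vspace 'rV[K]_n}) j w :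
  (forall I J, circuit I J -> j \in J -> (S <= flat I J)%VS -> chi (flat_stratum I J) <>
    Lambda) ->
  supported_above S w -> w \in W -> lift2 (ext_contract j) w \in W.
Proof.
move=> tm sw; pose Q (p : {set 'I_l} * {set 'I_m}) := (S <= flat p.1 p.2)%VS.
have hQ : homogeneous Q by move=> I J I' J' _ _ e; rewrite /Q /= e.
(* The expansion of [w] in generators may involve some that do not lie above [S]; truncating inside
   the map discards them. *)
have -> : lift2 (ext_contract j) w = (lift2 (ext_contract j) \o restr Q) w.
  by rewrite /= restr_id // => -[I J]; apply: sw.
apply: relations_stable => I J J' K1 K2 C c JJ' /=.
have [-> | [-> h]] := restr_relation_gen K1 K2 hQ C JJ'; first by rewrite linear0 mem0v.
rewrite lift2_tensor /= ext_contract_basis; case: ifP => jJ'; last first.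
  by rewrite tensor0r mem0v.
rewrite tensorZr; apply: memvZ; have [jJ | jJ] := boolP (j \in J); last first.
  by apply: mem_relations C c _ (mem_ext_ideal _ _ _); rewrite subsetD1 JJ'.
have [-> | /eqP nz] := eqVneq (relation_gen I K1 K2) 0.
  by rewrite tensor0l mem0v.
have [/existsP [A nzA] | /existsPn none] := boolP [exists A, relation_gen I K1 K2 A != 0];
  last first.
  by case: nz; apply/ffunP => A; have := none A; rewrite negbK => /eqP ->; rewrite ffunE.
have := h (A, J'); rewrite ffunE /= ext_basisE eqxx mulr1 => /(_ nzA); rewrite /Q /=.
have [_ ->] := relation_genL_flat C JJ' nzA => SF.
case: (tm I J C jJ _ c); apply: subv_trans SF (flatS _ _ _ _); rewrite ?subsetUr //.
Qed.

Hypothesis tameB : tame B.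

(* A lambda-circuit (set0, J0) yields no relation, as d(1) = 0. Tameness then gives
   an L_i containing M_J0, hence a lambda-circuit ([set i], J1) with J1 contained in
   J0, whose ideal is everything because d(e_i) = 1. The case of mu is dual. *)
Lemma dependent_basis I J : dependent L M I J ->
  tensor (ext_basis I) (ext_basis J) \in W \/ (forall u, u \in U -> u (I, J) = 0).
Proof.
have dL := @bi_dim_L _ _ _ _ B; have dM := @bi_dim_M _ _ _ _ B.
move=> /exists_circuit [I0 [J0 [II JJ C]]].
have strictP A A' : (A, A') != (set0, set0) -> strict (flat_stratum A A').
  rewrite xpair_eqE negb_and => nz; apply/eqP; rewrite /stratum_space /= => e.
  have dV : \dim (@fullv K 'rV[K]_n) = n by rewrite dimvf /dim /= mul1n.
  case/orP: nz => /set0Pn [h hA].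
    by have := dimvS (flat_subL L M A' hA); rewrite e dV -ltnS dL ltnn.
  by have := dimvS (flat_subM L M A hA); rewrite e dV -ltnS dM ltnn.
have coef u : u (I, J) = \sum_A ext_basis J A * u (I, A).
  rewrite (bigD1 J) //= ext_basisE eqxx mul1r big1 ?addr0 // => A /negPf AJ.
  by rewrite ext_basisE AJ mul0r.
case c: (chi (flat_stratum I0 J0)); [left | right].
  have [e | I00] := eqVneq I0 set0; last first.
    exact: mem_relations C c JJ (ext_ideal_basis I00 II).
  rewrite {I0 II}e in C c.
  have [e | /set0Pn [j jJ0]] := eqVneq J0 set0.
    by have := circuit_dependent C; rewrite e (negPf (dependent_set0 _ _)).
  have /tameB [[_ [i Si tm]]|[]] : strict (flat_stratum set0 J0).
  - by apply: strictP; rewrite xpair_eqE negb_and orbC; apply/orP; left; apply/set0Pn; exists j.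
  - have D : dependent L M (i |: set0) (J0 :\ j).
      by apply: dependent_subL; rewrite ?inE // (circuit_flatD1M dL dM C jJ0).
    have [I1 [J1 [I1i J1J C1]]] := exists_circuit D.
    have J1J0 : J1 \subset J0 := subset_trans J1J (subD1set _ _).
    (* Were [I1] empty, the new circuit would sit inside [J0 :\ j], against the minimality of
       [J0]. *)
    have eI1 : I1 = [set i].
      move: I1i; rewrite setU0 subset1 => /orP [/eqP // | /eqP I10]; rewrite {}I10 in C1.
      have [_ e] := circuit_minimal C (subxx _) J1J0 (circuit_dependent C1).
      by move/subsetP/(_ j): J1J; rewrite e jJ0 setD11 => /(_ isT).
    rewrite {I1 I1i}eI1 in C1.
    apply: (mem_relations C1 _ (subset_trans J1J0 JJ)); last exact: ext_ideal_set1.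
    have := tm _ _ C1 (set11 i); case: (chi _) => // h; case: h => //.
    apply/subv_flatP; split=> [h | h hJ1]; first by rewrite inE => /eqP ->.
    by apply: flat_subM; apply: (subsetP J1J0).
  - by rewrite c.
have [e | J00] := eqVneq J0 set0; last first.
  by move=> u uU; rewrite coef; apply: corelations_perp0 C c II (ext_ideal_basis J00 JJ) uU.
rewrite {J0 JJ}e in C c.
have [e | /set0Pn [i iI0]] := eqVneq I0 set0.
  by have := circuit_dependent C; rewrite e (negPf (dependent_set0 _ _)).
have /tameB [[]|[_ [j Sj tm]]] : strict (flat_stratum I0 set0).
- by apply: strictP; rewrite xpair_eqE negb_and; apply/orP; left; apply/set0Pn; exists i.
- by rewrite c.
have D : dependent L M (I0 :\ i) (j |: set0).
  by apply: dependent_subM; rewrite ?inE // (circuit_flatD1L dL dM C iI0).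
have [I1 [J1 [I1I J1j C1]]] := exists_circuit D.
have I1I0 : I1 \subset I0 := subset_trans I1I (subD1set _ _).
have eJ1 : J1 = [set j].
  move: J1j; rewrite setU0 subset1 => /orP [/eqP // | /eqP J10]; rewrite {}J10 in C1.
  have [e _] := circuit_minimal C I1I0 (subxx _) (circuit_dependent C1).
  by move/subsetP/(_ i): I1I; rewrite e iI0 setD11 => /(_ isT).
rewrite {J1 J1j}eJ1 in C1.
move=> u uU; rewrite coef.
apply: (corelations_perp0 C1 _ (subset_trans I1I0 II) (ext_ideal_set1 _ _) uU).
have := tm _ _ C1 (set11 j); case: (chi _) => // h; case: h => //.
apply/subv_flatP; split=> [h hI1 | h]; last by rewrite inE => /eqP ->.
by apply: flat_subL; apply: (subsetP I1I0).
Qed.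

(** Dependence is phrased through the codimension so that it visibly depends only on the bidegree
    and the flat, which makes it homogeneous. *)
Definition dependent_pair (p : {set 'I_l} * {set 'I_m}) :=
  codim (flat_stratum p.1 p.2) != (#|p.1| + #|p.2|)%N.

Lemma restr_dependent u : u \in U -> restr dependent_pair u \in W.
Proof.
move=> uU; rewrite [restr _ _]tensor_basis_sum; apply: rpred_sum => -[I J] _.
rewrite restrE; case: ifP => [D | _]; last by rewrite scale0r mem0v.
have {}D : dependent L M I J.
  apply: contraR D => nD.
  by rewrite /dependent_pair (independent_codim (@bi_dim_L _ _ _ _ B) (@bi_dim_M _ _ _ _
    B)) ?eqxx.
have [h | ->] := dependent_basis D; [exact: memvZ | by rewrite scale0r mem0v | by []].
Qed.

Lemma homogeneous_dependent : homogeneous dependent_pair.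
Proof.
move=> I J I' J' e1 e2 e; rewrite /dependent_pair /codim /stratum_space /=.
by rewrite e e1 e2.
Qed.

End Relations.

(** * The explicit subquotient *)

Lemma subquot_projK (F : fieldType) (V : vectType F) (U W : {vspace V}) u :
  u \in U -> subquot_lift U W (subquot_proj U W u) - u \in (U :&: W)%VS.
Proof.
move=> uU; have [lU lK] := subquot_liftK (subquot_proj U W u).
have dU : subquot_lift U W (subquot_proj U W u) - u \in U by rewrite memvB.
by rewrite memv_cap dU -(subquot_proj_eq0 W dU) linearB /= lK subrr.
Qed.

Lemma subquot_map_proj (F : fieldType) (V : vectType F) (U W : {vspace V})
    (f : 'End(V)) u :
  (f @: U <= U)%VS -> (f @: (U :&: W) <= U :&: W)%VS -> u \in U ->
  subquot_map U W f (subquot_proj U W u) = subquot_proj U W (f u).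
Proof.
move=> fU fUW uU; apply/eqP.
rewrite [subquot_map _ _ _ _]comp_lfunE [(subquot_proj U W \o f)%VF _]comp_lfunE.
have /(memv_img f)/(subvP fUW) := subquot_projK W uU.
rewrite memv_cap linearB /= => /andP [dU dW].
by have := subquot_proj_eq0 W dU; rewrite dW linearB /= subr_eq0.
Qed.

Section ExplicitSubquotient.
Variables (K : fieldType) (n l m : nat) (B : biarrangement K n l m).
Hypothesis tameB : tame B.
Local Notation E := {ffun {set 'I_l} * {set 'I_m} -> rat^o}.
Local Notation L := (bi_L B).
Local Notation M := (bi_M B).
Local Notation flat := (flat L M).
Local Notation flat_stratum := (flat_stratum L M).
Local Notation stratum := (stratum L M).
Local Notation strata := (strata L M).
Local Notation chi := (bi_chi B).
Local Notation U := (corelations_perp B).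
Local Notation W := (relations B).
Local Notation proj := (subquot_proj U W).
Local Notation A := (expl_bicomplex B).
Implicit Types (u : E) (p : {set 'I_l} * {set 'I_m}).

Definition in_bidegree i j p := (#|p.1| == i) && (#|p.2| == j).
Definition in_class i j (S : stratum) p :=
  [&& #|p.1| == i, #|p.2| == j & flat_stratum p.1 p.2 == S].

Lemma homogeneous_class i j S : homogeneous B (in_class i j S).
Proof.
move=> I J I' J' e1 e2 e; rewrite /in_class /= e1 e2.
by congr [&& _, _ & (_ == _)]; apply: val_inj.
Qed.

Local Notation part i j S := (restr (in_class i j S)).

Lemma part_U i j S u : u \in U -> part i j S u \in U.
Proof. exact/restr_corelations_perp/homogeneous_class. Qed.

Lemma part_W i j S u : u \in W -> part i j S u \in W.
Proof. exact/restr_relations/homogeneous_class. Qed.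

Lemma part_coef i j S u p : part i j S u p != 0 -> in_class i j S p /\ u p != 0.
Proof. by rewrite restrE; case: ifP => //; rewrite eqxx. Qed.

Lemma part_id i j S u : (forall p, u p != 0 -> in_class i j S p) -> part i j S u = u.
Proof. exact: restr_id. Qed.

Lemma part_eq0 i j S u : (forall p, in_class i j S p -> u p = 0) -> part i j S u = 0.
Proof.
by move=> h; apply/ffunP => p; rewrite restrE [RHS]ffunE; case: ifP => // /h.
Qed.

Lemma part_part_eq0 i j i' j' S S' u : S != S' -> part i j S (part i' j' S' u) = 0.
Proof.
move=> SS'; apply: part_eq0 => p /and3P [_ _ /eqP e]; rewrite restrE.
by case: ifP => // /and3P [_ _ /eqP e']; case/eqP: SS'; rewrite -e -e'.
Qed.

Lemma proj_eq0 u : u \in U -> (proj u == 0) = (u \in W).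
Proof. exact: subquot_proj_eq0. Qed.

Lemma passes_d1 : passes_to_subquotient B (linfun (@tensor_d1 l m)).
Proof.
split; apply/subvP => _ /memv_imgP [u uU ->]; rewrite lfunE /=.
  exact: tensor_d1_corelations_perp.
move: uU; rewrite !memv_cap => /andP [uU uW].
by rewrite tensor_d1_corelations_perp ?tensor_d1_relations.
Qed.

Lemma passes_d2 : passes_to_subquotient B (linfun (@tensor_d2 l m)).
Proof.
split; apply/subvP => _ /memv_imgP [u uU ->]; rewrite lfunE /=.
  exact: tensor_d2_corelations_perp.
move: uU; rewrite !memv_cap => /andP [uU uW].
by rewrite tensor_d2_corelations_perp ?tensor_d2_relations.
Qed.

Lemma expl_d1_proj u : u \in U -> expl_d1 B (proj u) = proj (tensor_d1 u).
Proof.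
by move=> uU; have [h1 h2] := passes_d1; rewrite /expl_d1 subquot_map_proj // [linfun _ u]lfunE.
Qed.

Lemma expl_d2_proj u : u \in U -> expl_d2 B (proj u) = proj (tensor_d2 u).
Proof.
by move=> uU; have [h1 h2] := passes_d2; rewrite /expl_d2 subquot_map_proj // [linfun _ u]lfunE.
Qed.

Lemma expl_stratumP i j S x :
  reflect (exists2 u, u \in U & part i j S u = u /\ x = proj u) (x \in expl_stratum i j S).
Proof.
apply: (iffP memv_imgP) => [[u] | [u uU [e ->]]].
  rewrite memv_cap => /andP [uU /mem_basis_span h] ->.
  by exists u => //; split=> //; apply: part_id.
exists u => //; rewrite memv_cap uU; apply/mem_basis_span => p.
by rewrite -e => /part_coef [].
Qed.

Lemma proj_part_mem i j S u : u \in U -> proj (part i j S u) \in expl_stratum i j S.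
Proof.
move=> uU; apply/expl_stratumP; exists (part i j S u); rewrite ?part_U //.
by split=> //; apply: part_id => p /part_coef [].
Qed.

Lemma sum_part (X : finType) i j (f : X -> strata (i + j)) u :
  injective f -> (forall p, u p != 0 -> in_bidegree i j p) ->
  (forall (S : strata (i + j)) p, u p != 0 -> flat_stratum p.1 p.2 = val S ->
     exists x, f x = S) ->
  u = \sum_x part i j (val (f x)) u + restr (dependent_pair B) u.
Proof.
move=> fI degu fS; apply/ffunP => p; rewrite [RHS]ffunE sum_ffunE restrE.
have [u0 | nz] := eqVneq (u p) 0.
  by rewrite big1 => [|x _]; rewrite ?restrE u0 ?if_same ?addr0.
have /andP [/eqP e1 /eqP e2] := degu _ nz.
rewrite /dependent_pair e1 e2; case: eqP => [/eqP c | c] /=.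
  pose S : strata (i + j) := exist _ (flat_stratum p.1 p.2) c.
  have [x xS] := fS S _ nz erefl.
  have cl y : in_class i j (val (f y)) p = (x == y).
    rewrite -(inj_eq fI) xS /in_class e1 e2 (eqxx i) (eqxx j) !andTb.
    exact: (inj_eq val_inj S (f y)).
  have key y : part i j (val (f y)) u p = if x == y then u p else 0.
    by rewrite [LHS]restrE cl.
  rewrite (eq_bigr (fun y => if x == y then u p else 0)) => [|y _]; last exact: key.
  by rewrite -big_mkcond (big_pred1 x) ?addr0 // => y; rewrite eq_sym.
rewrite big1 ?add0r // => x _; rewrite restrE; case: ifP => // /and3P [_ _ /eqP e].
by case: c; rewrite e; apply/eqP/(valP (f x)).
Qed.

Lemma proj_restr_dependent u : u \in U -> proj (restr (dependent_pair B) u) = 0.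
Proof.
move=> uU; apply/eqP; rewrite proj_eq0 ?restr_dependent //.
exact: restr_corelations_perp (@homogeneous_dependent _ _ _ _ B) uU.
Qed.

Lemma proj_sum_part i j u : u \in U -> (forall p, u p != 0 -> in_bidegree i j p) ->
  proj u = \sum_(S : strata (i + j)) proj (part i j (val S) u).
Proof.
move=> uU degu; rewrite {1}(@sum_part _ i j id u) //; last by move=> S; exists S.
by rewrite linearD linear_sum /= proj_restr_dependent // addr0.
Qed.

(** Truncation to the class of [S] isolates one summand and preserves $R$, so a sum of
    representatives lying in $R$ has each of its terms in $R$. *)
Lemma expl_strata_direct i j :
  directv (\sum_(S : strata (i + j)) expl_stratum i j (val S))%VS.
Proof.
apply/directv_sum_independent => us usP us0 S _.
have /fin_all_exists2 [v vU vP] : forall S : strata (i + j),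
    exists2 u, u \in U & part i j (val S) u = u /\ us S = proj u.
  by move=> S'; apply/expl_stratumP/usP.
have [_ ->] := vP S; apply/eqP; rewrite proj_eq0 //.
have : \sum_S v S \in W.
  rewrite -proj_eq0 ?rpred_sum // linear_sum /= (eq_bigr us) ?us0 // => S' _.
  by have [_ ->] := vP S'.
move/(part_W i j (val S)); rewrite linear_sum (bigD1 S) //= big1 ?addr0.
  by have [-> _] := vP S.
move=> S' SS'; have [<- _] := vP S'; apply: part_part_eq0.
by rewrite (inj_eq val_inj) eq_sym.
Qed.

(** Truncations give one decomposition of [proj u] over the strata, [sumv_pi] another; they agree
    because the sum is direct. *)
Lemma expl_component_proj i j (T : strata (i + j)) u :
  u \in U -> (forall p, u p != 0 -> in_bidegree i j p) ->
  expl_incl T (expl_component T (proj u)) = proj (part i j (val T) u).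
Proof.
move=> uU degu; rewrite lfunE /expl_component comp_lfunE lfunE /= vsprojK ?memv_sum_pi //.
have h S : proj (part i j (val S) u) \in expl_stratum i j (val S) by apply: proj_part_mem.
have uS : proj u \in (\sum_(S : strata (i + j)) expl_stratum i j (val S))%VS.
  by rewrite (proj_sum_part uU degu) memv_sumr.
have /eqP := sumv_pi_sum (erefl _) uS; rewrite {2}(proj_sum_part uU degu).
rewrite (directv_sum_unique (expl_strata_direct i j)) => // [/forall_inP/(_ T isT)/eqP // |S _].
exact: memv_sum_pi.
Qed.

Lemma d1_bidegree i j u : (forall p, u p != 0 -> in_bidegree i.+1 j p) ->
  forall p, tensor_d1 u p != 0 -> in_bidegree i j p.
Proof.
move=> degu [I J]; rewrite tensor_d1_coef; apply: contraR => ndeg; rewrite big1 // => h hI.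
apply/eqP; rewrite mulf_eq0; apply/orP; right; apply: contraR ndeg => /degu.
by rewrite /in_bidegree /= cardsU1 hI add1n eqSS.
Qed.

Lemma d2_bidegree i j u : (forall p, u p != 0 -> in_bidegree i j p) ->
  forall p, tensor_d2 u p != 0 -> in_bidegree i j.+1 p.
Proof.
move=> degu [I J]; rewrite tensor_d2_coef; apply: contraR => ndeg; rewrite big1 // => h hJ.
apply/eqP; rewrite mulf_eq0; apply/orP; right; apply: contraR ndeg => /degu.
by rewrite /in_bidegree /= (cardsD1 h J) hJ add1n eqSS.
Qed.

(** $d'$ drops hyperplanes, so it can only reach larger flats. *)
Lemma part_d1_eq0 i j i' j' (S T : stratum) u :
  (forall p, u p != 0 -> in_class i' j' S p) -> ~~ (S <= T)%VS ->
  part i j T (tensor_d1 u) = 0.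
Proof.
move=> uS ST; apply: part_eq0 => -[I J] /and3P [_ _ /eqP eT].
rewrite tensor_d1_coef big1 // => h _.
apply/eqP; rewrite mulf_eq0; apply/orP; right; apply: contraR ST => /uS /and3P [_ _ /eqP <-].
by rewrite -eT; apply: flatS; rewrite /= ?subsetUr.
Qed.

Lemma part_d2_eq0 i j i' j' (S T : stratum) u :
  (forall p, u p != 0 -> in_class i' j' T p) -> ~~ (S <= T)%VS ->
  part i j S (tensor_d2 u) = 0.
Proof.
move=> uT ST; apply: part_eq0 => -[I J] /and3P [_ _ /eqP eS].
rewrite tensor_d2_coef big1 // => h _.
apply/eqP; rewrite mulf_eq0; apply/orP; right; apply: contraR ST => /uT /and3P [_ _ /eqP <-].
by rewrite -eS; apply: flatS; rewrite /= ?subD1set.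
Qed.

Lemma expl_incl_mem i j (S : strata (i + j)) (x : expl_space S) :
  expl_incl S x \in expl_stratum i j (val S).
Proof. rewrite lfunE; exact: subvsP. Qed.

Lemma expl_incl_inj i j (S : strata (i + j)) : injective (expl_incl S).
Proof. by move=> x y; rewrite !lfunE; apply: val_inj. Qed.

Lemma expl_incl_vsproj i j (S : strata (i + j)) y :
  y \in expl_stratum i j (val S) -> expl_incl S (vsproj _ y) = y.
Proof. by move=> yS; rewrite lfunE /= vsprojK. Qed.

Lemma bc_d1E i j (S : strata (i.+1 + j)) (T : strata (i + j)) :
  bc_d1 A S T = (expl_component T \o expl_d1 B \o expl_incl S)%VF.
Proof. by []. Qed.

Lemma bc_d2E i j (S : strata (i + j.+1)) (T : strata (i + j)) :
  bc_d2 A S T = (expl_component S \o expl_d2 B \o expl_incl T)%VF.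
Proof. by []. Qed.

Lemma bc_d1_val i j (S : strata (i.+1 + j)) (T : strata (i + j)) (x : expl_space S) :
  bc_d1 A S T x = expl_component T (expl_d1 B (expl_incl S x)).
Proof. by rewrite bc_d1E comp_lfunE comp_lfunE. Qed.

Lemma bc_d2_val i j (S : strata (i + j.+1)) (T : strata (i + j)) (x : expl_space T) :
  bc_d2 A S T x = expl_component S (expl_d2 B (expl_incl T x)).
Proof. by rewrite bc_d2E comp_lfunE comp_lfunE. Qed.

Lemma bc_d1_proj i j (S : strata (i.+1 + j)) (T : strata (i + j)) (x : expl_space S) u :
  u \in U -> (forall p, u p != 0 -> in_bidegree i.+1 j p) -> expl_incl S x = proj u ->
  expl_incl T (bc_d1 A S T x) = proj (part i j (val T) (tensor_d1 u)).
Proof.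
move=> uU degu e; etransitivity; first exact: (congr1 (expl_incl T) (bc_d1_val T x)).
etransitivity; first exact: (congr1 (fun y => expl_incl T (expl_component T (expl_d1 B y))) e).
etransitivity; first exact: (congr1 (fun y => expl_incl T (expl_component T y))
  (expl_d1_proj uU)).
exact: expl_component_proj (tensor_d1_corelations_perp uU) (d1_bidegree degu).
Qed.

Lemma bc_d2_proj i j (S : strata (i + j.+1)) (T : strata (i + j)) (x : expl_space T) u :
  u \in U -> (forall p, u p != 0 -> in_bidegree i j p) -> expl_incl T x = proj u ->
  expl_incl S (bc_d2 A S T x) = proj (part i j.+1 (val S) (tensor_d2 u)).
Proof.
move=> uU degu e; etransitivity; first exact: (congr1 (expl_incl S) (bc_d2_val S x)).
etransitivity; first exact: (congr1 (fun y => expl_incl S (expl_component S (expl_d2 B y))) e).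
etransitivity; first exact: (congr1 (fun y => expl_incl S (expl_component S y))
  (expl_d2_proj uU)).
exact: expl_component_proj (tensor_d2_corelations_perp uU) (d2_bidegree degu).
Qed.

Lemma class_bidegree i j S p : in_class i j S p -> in_bidegree i j p.
Proof. by case/and3P => h1 h2 _; apply/andP. Qed.

Lemma part_fix_class i j S u : part i j S u = u -> forall p, u p != 0 -> in_class i j S p.
Proof. by move=> <- p /part_coef []. Qed.

Lemma explicit_decomposition : expl_decomposition B.
Proof.
split=> [i j | i j S x | i j T x].
- split; last exact: expl_strata_direct.
  apply/eqP; rewrite eqEsubv; apply/andP; split.
    apply/subvP => x /memv_imgP [u]; rewrite memv_cap => /andP [uU /mem_basis_span degu] ->.
    by rewrite (proj_sum_part uU degu); apply: memv_sumr => S _; apply: proj_part_mem.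
  apply/subv_sumP => S _; apply/limgS/capvS => //.
  apply/subvP => u /mem_basis_span h; apply/mem_basis_span => p /h.
  exact: class_bidegree.
- have /expl_stratumP [u uU [/part_fix_class eu xu]] := expl_incl_mem x.
  have degu p : u p != 0 -> in_bidegree i.+1 j p by move/eu/class_bidegree.
  have dU := tensor_d1_corelations_perp uU.
  etransitivity; first exact: (congr1 (expl_d1 B) xu).
  etransitivity; first exact: (expl_d1_proj uU).
  etransitivity; first exact: (proj_sum_part dU (d1_bidegree degu)).
  rewrite [RHS]big_mkcond; apply: eq_bigr => T _; case: ifPn => ST.
    exact: esym (bc_d1_proj T uU degu xu).
  by rewrite (part_d1_eq0 _ _ eu) // linear0.
- have /expl_stratumP [u uU [/part_fix_class eu xu]] := expl_incl_mem x.
  have degu p : u p != 0 -> in_bidegree i j p by move/eu/class_bidegree.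
  have dU := tensor_d2_corelations_perp uU.
  etransitivity; first exact: (congr1 (expl_d2 B) xu).
  etransitivity; first exact: (expl_d2_proj uU).
  etransitivity; first exact: (proj_sum_part dU (d2_bidegree degu)).
  rewrite [RHS]big_mkcond; apply: eq_bigr => S _; case: ifPn => ST.
    exact: esym (bc_d2_proj S uU degu xu).
  by rewrite (part_d2_eq0 _ _ eu) // linear0.
Qed.

(** * Local sums represented by vectors of the tensor product; exactness of the explicit
    bi-complex *)

Section Lifts.
Variable Sigma : stratum.
Local Notation local_sum := (local_sum A Sigma).

Definition local_support i j u :=
  forall p, u p != 0 -> in_bidegree i j p /\ (Sigma <= flat_stratum p.1 p.2)%VS.

(** Replaces a dependent family of vectors in subquotients by one vector of $C^\perp$ supported
    above [Sigma], on which multiplication and contraction can act. *)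
Definition lifts i j (x : local_sum i j) u :=
  [/\ u \in U, local_support i j u
    & forall S : above Sigma (i + j), expl_incl (val S) (x S) = proj (part i j (val (val S)) u)].

Lemma lifts_exists i j (x : local_sum i j) : exists u, lifts x u.
Proof.
have /fin_all_exists2 [v vU vP] : forall S : above Sigma (i + j),
    exists2 u, u \in U & part i j (val (val S)) u = u /\ expl_incl (val S) (x S) = proj u.
  by move=> S; apply/expl_stratumP; apply: (expl_incl_mem (x S)).
exists (\sum_S v S); split; first exact: rpred_sum.
  move=> p; rewrite sum_ffunE => nz.
  have [S nzS] : exists S, v S p != 0.
    by apply/existsP; apply: contraR nz => /existsPn h; apply/eqP/big1 => S _; apply/eqP;
      have := h S; rewrite negbK.
  have [/part_fix_class/(_ _ nzS) c _] := vP S; split; first exact: class_bidegree c.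
  by case/and3P: c => _ _ /eqP ->; apply: (valP S).
move=> S; have [e ->] := vP S; rewrite linear_sum (bigD1 S) //= e big1 ?addr0 // => S' SS'.
have [<- _] := vP S'; apply: part_part_eq0.
by rewrite !(inj_eq val_inj) eq_sym.
Qed.

Lemma lifts_surj i j u : u \in U -> local_support i j u ->
  exists x : local_sum i j, lifts x u.
Proof.
move=> uU su.
exists (fun S => vsproj (expl_stratum i j (val (val S))) (proj (part i j (val (val S)) u))).
by split=> // S; apply: expl_incl_vsproj; apply: proj_part_mem.
Qed.

Lemma local_sum_part i j u : local_support i j u ->
  u = \sum_(S : above Sigma (i + j)) part i j (val (val S)) u + restr (dependent_pair B) u.
Proof.
move=> su; apply: sum_part; first exact: val_inj.
  by move=> p /su [].
by move=> S p /su [_ h] e; rewrite e in h; exists (exist _ S h).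
Qed.

Lemma sum_local_parts (V : lmodType rat) (g : {linear E -> V}) i j u
    (P : pred (above Sigma (i + j))) :
  local_support i j u -> g (restr (dependent_pair B) u) = 0 ->
  (forall S, ~~ P S -> g (part i j (val (val S)) u) = 0) ->
  \sum_(S | P S) g (part i j (val (val S)) u) = g u.
Proof.
move=> su gdep gP; rewrite [in RHS](local_sum_part su) linearD gdep addr0 linear_sum.
by rewrite big_mkcond; apply: eq_bigr => S _; case: ifPn => // /gP.
Qed.

(** [u] is the sum of its parts up to a dependent remainder, which lies in $R$ and stays there under
    $d'$. *)
Lemma proj_d1_parts i j u (T : stratum) (P : pred (above Sigma (i.+1 + j))) :
  u \in U -> local_support i.+1 j u ->
  (forall S : above Sigma (i.+1 + j), (val (val S) <= T)%VS -> P S) ->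
  \sum_(S | P S) proj (part i j T (tensor_d1 (part i.+1 j (val (val S)) u))) =
  proj (part i j T (tensor_d1 u)).
Proof.
move=> uU su hP.
pose g : {linear E -> expl B} := (proj \o (part i j T \o @tensor_d1 l m)).
apply: (@sum_local_parts _ g) => // [|S nP].
  have dW := tensor_d1_relations (restr_dependent tameB uU).
  have dU := tensor_d1_corelations_perp (restr_corelations_perp (@homogeneous_dependent _ _
    _ _ B) uU).
  by apply/eqP; rewrite [g _ == 0](proj_eq0 (part_U i j T dU)); apply: part_W.
have e : part i j T (tensor_d1 (part i.+1 j (val (val S)) u)) = 0.
  apply: part_d1_eq0 => [p /part_coef [pc _] | ]; first exact: pc.
  by apply: contra nP; apply: hP.
by rewrite /g /= e linear0.
Qed.

Lemma proj_d2_parts i j u (S : stratum) (P : pred (above Sigma (i + j))) :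
  u \in U -> local_support i j u ->
  (forall T : above Sigma (i + j), (S <= val (val T))%VS -> P T) ->
  \sum_(T | P T) proj (part i j.+1 S (tensor_d2 (part i j (val (val T)) u))) =
  proj (part i j.+1 S (tensor_d2 u)).
Proof.
move=> uU su hP.
pose g : {linear E -> expl B} := (proj \o (part i j.+1 S \o @tensor_d2 l m)).
apply: (@sum_local_parts _ g) => // [|T nP].
  have dW := tensor_d2_relations (restr_dependent tameB uU).
  have dU := tensor_d2_corelations_perp (restr_corelations_perp (@homogeneous_dependent _ _
    _ _ B) uU).
  by apply/eqP; rewrite [g _ == 0](proj_eq0 (part_U i j.+1 S dU)); apply: part_W.
have e : part i j.+1 S (tensor_d2 (part i j (val (val T)) u)) = 0.
  apply: part_d2_eq0 => [p /part_coef [pc _] | ]; first exact: pc.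
  by apply: contra nP; apply: hP.
by rewrite /g /= e linear0.
Qed.

Lemma lifts_d1 i j (x : local_sum i.+1 j) u :
  lifts x u -> lifts (local_d1 x) (tensor_d1 u).
Proof.
move=> [uU su xu]; split; first exact: tensor_d1_corelations_perp.
  move=> p nz; split; first exact: d1_bidegree (fun p h => proj1 (su p h)) p nz.
  apply: contraNT nz => nS; case: p nS => I J nS; rewrite tensor_d1_coef big1 // => h _.
  apply/eqP; rewrite mulf_eq0; apply/orP; right; apply: contraR nS => /su [_ sS].
  by apply: subv_trans sS (flatS _ _ _ _); rewrite /= ?subsetUr.
move=> T; etransitivity; last exact: (@proj_d1_parts i j u (val (val T)) _ uU su (fun S h => h)).
etransitivity; first exact: linear_sum.
apply: eq_bigr => S _; apply: bc_d1_proj (part_U _ _ _ uU) _ (xu S).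
by move=> p /part_coef [/class_bidegree].
Qed.

(* The complement of A^{<= Sigma} is stable under d'' but A^{<= Sigma} is not,
   so that d'' is truncated to the f_J with Sigma contained in M_J; this
   truncation, unlike the one to A^{<= Sigma}, commutes with d'. *)
Definition M_above p := (Sigma <= flat set0 p.2)%VS.

Definition local_tensor_d2 u := restr M_above (tensor_d2 u).

Lemma M_aboveU1 I j J : M_above (I, j |: J) = (Sigma <= M j)%VS && M_above (I, J).
Proof.
rewrite /M_above /=; apply/subv_flatP/andP => [[_ h] | [hj /subv_flatP [_ hJ]]].
  split; first by apply: h; rewrite setU11.
  by apply/subv_flatP; split=> [i | h' hJ]; rewrite ?inE //; apply: h; rewrite inE hJ orbT.
by split=> [i | h]; rewrite !inE // => /orP [/eqP -> // | /hJ].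
Qed.

(** Below an index [J] selected by [M_above], every [J :\ j] is selected too, so truncating before
    $d''$ changes nothing. *)
Lemma restr_M_above_d2 u :
  restr M_above (tensor_d2 (restr M_above u)) = restr M_above (tensor_d2 u).
Proof.
apply/ffunP => -[I J]; rewrite !restrE; case: ifP => // QJ.
rewrite !tensor_d2_coef; apply: eq_bigr => j jJ; rewrite restrE.
by move: QJ; rewrite -{1}(setD1K jJ) M_aboveU1 => /andP [_ ->].
Qed.

Lemma restr_M_above_d1 u :
  restr M_above (tensor_d1 u) = tensor_d1 (restr M_above u).
Proof.
apply/ffunP => -[I J]; rewrite restrE !tensor_d1_coef.
by case: ifP => QJ; [apply: eq_bigr | rewrite big1] => // i _;
  rewrite restrE /M_above /= in QJ *; rewrite QJ ?mulr0.
Qed.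

Lemma subv_flat_split (I : {set 'I_l}) (J : {set 'I_m}) :
  (Sigma <= flat I J)%VS = (Sigma <= flat I set0)%VS && (Sigma <= flat set0 J)%VS.
Proof. by rewrite -{1}(setU0 I) -{1}(set0U J) flatU subv_cap. Qed.

Lemma local_tensor_d2_support i j u : local_support i j u ->
  local_support i j.+1 (local_tensor_d2 u).
Proof.
move=> su p; rewrite restrE; case: ifP => [Qp nz | _]; last by rewrite eqxx.
split; first exact: d2_bidegree (fun p h => proj1 (su p h)) p nz.
case: p Qp nz => I J QJ; rewrite tensor_d2_coef => nz.
rewrite /stratum_space /= subv_flat_split; apply/andP; split; last exact: QJ.
apply: contraNT nz => nI; rewrite big1 // => h _; apply/eqP.
rewrite mulf_eq0; apply/orP; right; apply: contraR nI => /su [_].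
by rewrite /stratum_space /= subv_flat_split => /andP [].
Qed.

Lemma homogeneous_above : homogeneous B (fun p => (Sigma <= flat p.1 p.2)%VS).
Proof. by move=> I J I' J' _ _ /= ->. Qed.

(** [M_above] depends on [J] and not on the flat, hence is not homogeneous; but when [u] is
    supported above [Sigma] it cuts $d''u$ exactly as the homogeneous condition on flats does. *)
Lemma local_tensor_d2_U i j u : local_support i j u -> u \in U -> local_tensor_d2 u \in U.
Proof.
move=> su uU; suff -> : local_tensor_d2 u =
    restr (fun p => Sigma <= flat p.1 p.2)%VS (tensor_d2 u).
  exact: restr_corelations_perp homogeneous_above (tensor_d2_corelations_perp uU).
apply/ffunP => -[I J]; rewrite !restrE; case: ifP => Q1; case: ifP => Q2 //.
  apply/eqP; apply: contraFT Q2 => nz; have := local_tensor_d2_support su (p := (I, J)).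
  by rewrite /local_tensor_d2 restrE Q1 => /(_ nz) [].
by move: Q2 Q1; rewrite /= subv_flat_split /M_above /= => /andP [_ ->].
Qed.

Lemma lifts_d2 i j (x : local_sum i j) u :
  lifts x u -> lifts (local_d2 x) (local_tensor_d2 u).
Proof.
move=> [uU su xu]; split; [exact: local_tensor_d2_U su uU | exact: local_tensor_d2_support|].
move=> S; have -> : part i j.+1 (val (val S)) (local_tensor_d2 u) =
                    part i j.+1 (val (val S)) (tensor_d2 u).
  apply/ffunP => -[I J]; rewrite restrE [RHS]restrE restrE; case: ifP => // /and3P [_ _ /eqP e].
  have := valP S; rewrite -e /stratum_space /= subv_flat_split => /andP [_].
  by rewrite /M_above /= => ->.
etransitivity; last exact: (@proj_d2_parts i j u (val (val S)) _ uU su (fun T h => h)).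
etransitivity; first exact: linear_sum.
apply: eq_bigr => T _; apply: bc_d2_proj (part_U _ _ _ uU) _ (xu T).
by move=> p /part_coef [/class_bidegree].
Qed.

(** The dictionary between identities of families and membership in $R$. From right to left, the
    dependent part of [u - v] has no component to test it and is handled by [restr_dependent]. *)
Lemma liftsB i j (x y : local_sum i j) u v : lifts x u -> lifts y v ->
  (u - v \in W) <-> (forall S, x S = y S).
Proof.
move=> [uU su xu] [vU sv yv]; have uvU : u - v \in U by rewrite memvB.
split=> [uvW S | xy].
  apply: (@expl_incl_inj _ _ (val S)); etransitivity; first exact: xu.
  etransitivity; last by symmetry; exact: yv.
  apply/eqP; rewrite -subr_eq0 -!linearB /= proj_eq0 ?part_U //; exact: part_W.
have suv : local_support i j (u - v).
  move=> p; rewrite !ffunE => nz; have [u0 | /su //] := eqVneq (u p) 0.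
  by apply: sv; move: nz; rewrite u0 add0r oppr_eq0.
rewrite (local_sum_part suv) rpredD ?restr_dependent // rpred_sum // => S _.
rewrite -proj_eq0 ?part_U // !linearB /= subr_eq0; apply/eqP.
by rewrite -xu -yv xy.
Qed.

Lemma lifts0 i j (x : local_sum i j) : lifts x 0 -> forall S, x S = 0.
Proof.
move=> [_ _ h] S; apply: (@expl_incl_inj _ _ (val S)); etransitivity; first exact: h.
by rewrite !linear0.
Qed.

Lemma lifts_zero i j : lifts ((fun=> 0) : local_sum i j) 0.
Proof.
split; [exact: mem0v | by move=> p; rewrite ffunE eqxx | by move=> S; rewrite !linear0].
Qed.

Lemma explicit_local_bicomplex : local_bicomplex A Sigma.
Proof.
split=> i j x.
- have [u xu] := lifts_exists x; apply: lifts0.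
  by rewrite -(tensor_d1_sqr0 u); do 2!apply: lifts_d1.
- have [u xu] := lifts_exists x; apply: lifts0.
  have <- : local_tensor_d2 (local_tensor_d2 u) = 0.
    by rewrite /local_tensor_d2 restr_M_above_d2 tensor_d2_sqr0 linear0.
  by do 2!apply: lifts_d2.
- have [u xu] := lifts_exists x.
  have h1 := lifts_d1 (lifts_d2 xu); have h2 := lifts_d2 (lifts_d1 xu).
  apply/(liftsB h1 h2); rewrite /local_tensor_d2 -restr_M_above_d1 tensor_d1_d2 subrr.
  exact: mem0v.
Qed.

Lemma explicit_exact : strict Sigma -> exact_stratum A Sigma.
Proof.
move=> sS i j ij; have [[-> [h Sh tm]] p _ | [-> [h Sh tm]] q _] := tameB sS.
  move=> x dx; have [u xu] := lifts_exists x; have [uU su _] := xu.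
  have vU : lift1 (ext_mul h) u \in U.
    by apply: (lift_mul_corelations_perp Sh tm) uU => I J /su [].
  have [y yv] : exists y : local_sum p.+1 j, lifts y (lift1 (ext_mul h) u).
    apply: lifts_surj vU _ => -[I J].
    have -> : lift1 (ext_mul h) u (I, J) = if h \in I then ext_sign h I * u (I :\ h, J) else 0.
      by rewrite !ffunE.
    case: ifP => [hI | _]; last by rewrite eqxx.
    rewrite mulf_eq0 negb_or => /andP [_ /su [/andP [/eqP c1 c2] s]]; split.
      by rewrite /in_bidegree c2 /= (cardsD1 h I) hI c1 eqxx.
    apply/subv_flatP; split=> [a aI | a aJ]; last exact: subv_trans s (flat_subM _ _ _ aJ).
    have [-> // | ah] := eqVneq a h.
    by apply: subv_trans s (flat_subL _ _ _ _); rewrite !inE ah.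
  (* $d'(e_h u) - u = -e_h\,d'u$ and $e_h$ preserves $R$, so it remains to place $d'u$ in $R$. *)
  exists y; apply/(liftsB (lifts_d1 yv) xu).
  rewrite -{2}(tensor_d1_mul h u) opprD addrA subrr add0r rpredN.
  apply: lift_mul_relations; case: p x dx xu su vU y yv => [|p] x dx xu su vU y yv.
    (* At the end of the row there is no cycle condition to use; $d'u$ vanishes for reasons of
       degree. *)
    rewrite (_ : tensor_d1 u = 0) ?mem0v //; apply/ffunP => -[I J].
    rewrite tensor_d1_coef [RHS]ffunE big1 // => a aI; apply/eqP; rewrite mulf_eq0.
    apply/orP; right; apply/negPn/negP => /su [/andP [/eqP c _] _].
    by move: c; rewrite /= cardsU1 aI.
  by rewrite -[tensor_d1 u]subr0; apply/(liftsB (lifts_d1 xu) (@lifts_zero p j)).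
(* The homotopy survives the truncation because [Sigma] lies in [M_h]: inserting [h] into [J] does
   not affect [M_above]. *)
have key u : local_tensor_d2 (lift2 (ext_contract h) u) +
    lift2 (ext_contract h) (local_tensor_d2 u) = restr M_above u.
  rewrite -{3}(tensor_d2_contract h u) linearD; congr (_ + _).
  apply/ffunP => -[I J]; rewrite restrE.
  have e v : lift2 (ext_contract h) v (I, J) = if h \in J then 0 else ext_sign h J * v (I,
    h |: J).
    by rewrite !ffunE.
  rewrite !e restrE M_aboveU1 Sh /=.
  by case: ifP; case: ifP; rewrite ?mulr0.
have small x0 (x : local_sum i x0) u : lifts x u -> (forall S, local_d2 x S = 0) ->
    lift2 (ext_contract h) (local_tensor_d2 u) \in W /\ restr M_above u = u.
  move=> xu dx; have [uU su _] := xu; split; last first.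
    apply: restr_id => -[I J] /su [_].
    by rewrite /stratum_space /= subv_flat_split => /andP [].
  apply: (lift_contract_relations (S := Sigma) (fun I J C hJ => tm I J C hJ)).
    by move=> I J /(local_tensor_d2_support su) [].
  by rewrite -[local_tensor_d2 u]subr0; apply/(liftsB (lifts_d2 xu) (@lifts_zero i x0.+1)).
case: q => [|q] x dx; have [u xu] := lifts_exists x; have [uU su _] := xu;
  have [W1 e1] := small _ _ _ xu dx; have k := key u; rewrite e1 in k.
  apply/(liftsB xu (@lifts_zero i 0)); rewrite subr0 -k rpredD //.
  (* At the start of the column [u] has degree 0 in the $f_j^\vee$, so its contraction is 0. *)
  rewrite (_ : lift2 _ u = 0) ?/local_tensor_d2 ?linear0 ?mem0v //.
  apply/ffunP => -[I J]; rewrite !ffunE; case: ifP => // hJ; apply/eqP; rewrite mulf_eq0.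
  apply/orP; right; apply/negPn/negP => /su [/andP [_ /eqP c] _].
  by move: c; rewrite /= cardsU1 hJ.
have vU := lift_contract_corelations_perp h uU.
have [y yv] : exists y : local_sum i q, lifts y (lift2 (ext_contract h) u).
  apply: lifts_surj vU _ => -[I J].
  have -> : lift2 (ext_contract h) u (I, J) = if h \in J then 0 else ext_sign h J * u (I, h |: J).
    by rewrite !ffunE.
  case: ifP => [_ | hJ]; first by rewrite eqxx.
  rewrite mulf_eq0 negb_or => /andP [_ /su [/andP [c1 /eqP c2] s]]; split.
    by move: c2; rewrite /in_bidegree c1 /= cardsU1 hJ /= add1n => -[->].
  apply: subv_trans s (flatS _ _ _ _); rewrite /= ?subsetUr //.
exists y; apply/(liftsB (lifts_d2 yv) xu).
by rewrite -{2}k opprD addrA subrr add0r rpredN.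
Qed.

End Lifts.

(** For degree reasons, a co-relation pairing nontrivially with 1 would come from a circuit made of
    a single hyperplane of [M], whose form is nonzero. *)
Lemma tensor_basis00 : tensor (ext_basis set0) (ext_basis set0) \in U.
Proof.
apply: mem_corelations_perp => I J I' K1 K2 C c II'; rewrite big1 // => D _.
rewrite tensor_basisE; case: eqP => [[eI' eD] | _]; rewrite ?mulr0 // mulr1.
apply/eqP/negPn/negP => /relation_gen_neq0 [j jJ []]; rewrite eD cards0 => _ /esym/eqP.
rewrite !addn_eq0 => /andP [_]; rewrite (cardsD1 j J) jJ /= cards_eq0 => /eqP J0.
have eI : I = set0 by apply/eqP; rewrite -subset0 -eI'.
have eJ : J = [set j] by rewrite -(setD1K jJ) J0 setU0.
have := circuit_dependent C; rewrite eI eJ; apply/negP.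
apply: dependent_set1M; exact: bi_dim_M.
Qed.

(** The coefficient at the empty pair kills $R$: a generator seen by it would come from a circuit
    made of a single hyperplane of [L]. *)
Lemma tensor_basis00_notin : tensor (ext_basis set0) (ext_basis set0) \notin W.
Proof.
pose f (v : E) : rat^o := v (set0, set0).
have fl : linear f by move=> a v w; rewrite /f !ffunE.
pose F : {linear E -> rat^o} := HB.pack f (GRing.isLinear.Build _ _ _ _ f fl).
have h : (W <= lker (linfun F))%VS.
  apply: relations_sub => I J J' K1 K2 C c JJ'; rewrite memv_ker lfunE /= /f ffunE /=.
  rewrite mulf_eq0 -[_ || _]negbK negb_or; apply/negP => /andP [].
  move=> /relation_gen_neq0 [i iI []]; rewrite cards0 => _ /esym/eqP.
  rewrite !addn_eq0 => /andP [_]; rewrite (cardsD1 i I) iI /= cards_eq0 => /eqP I0.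
  rewrite ext_basisE; have [eJ' _ | _] := eqVneq set0 J'; last by rewrite eqxx.
  have eJ : J = set0 by apply/eqP; rewrite -subset0 eJ'.
  have eI : I = [set i] by rewrite -(setD1K iI) I0 setU0.
  have := circuit_dependent C; rewrite eI eJ; apply/negP.
  apply: dependent_set1L; exact: bi_dim_L.
apply/negP => /(subvP h); rewrite memv_ker lfunE /= /f tensor_basisE eqxx.
by rewrite oner_eq0.
Qed.

Lemma explicit_one :
  bc_one A != 0 /\ fullv = <[bc_one A]>%VS.
Proof.
pose t : E := tensor (ext_basis set0) (ext_basis set0).
have tS p : t p != 0 -> in_class 0 0 (val (ambient L M)) p.
  rewrite /t tensor_basisE; have [-> _ | _] := eqVneq p (set0, set0); last by rewrite eqxx.
  by apply/and3P; split; rewrite ?cards0.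
have e : expl_incl (i := 0) (j := 0) (ambient L M) (bc_one A) = proj t.
  have tm : proj t \in expl_stratum 0 0 (val (ambient L M)).
    rewrite -(part_id tS); apply: proj_part_mem; exact: tensor_basis00.
  exact: (expl_incl_vsproj (i := 0) (j := 0) (S := ambient L M) tm).
have nz : proj t != 0 by rewrite proj_eq0 ?tensor_basis00 // tensor_basis00_notin.
split; first by apply: contraNneq nz => z; rewrite -e z linear0.
apply/vspaceP => x; rewrite memvf; apply/esym/vlineP.
have /expl_stratumP [u uU [/part_fix_class eu xu]] :=
  expl_incl_mem (i := 0) (j := 0) (S := ambient L M) x.
exists (u (set0, set0)); apply: (@expl_incl_inj 0 0 (ambient L M)).
rewrite [RHS]linearZ /= e; etransitivity; first exact: xu.
rewrite -linearZ; congr (proj _); apply/ffunP => p; rewrite [RHS]ffunE /t tensor_basisE.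
rewrite -[_ *: _]/(_ * _); have [-> | /eqP np] := eqVneq p (set0, set0); first by rewrite mulr1.
rewrite mulr0; apply/eqP/negPn/negP => /eu /and3P [].
by rewrite !cards_eq0; case: p np => I J np /eqP /= eI /eqP /= eJ; case: np; rewrite eI eJ.
Qed.

Lemma explicit_Orlik_Solomon : is_Orlik_Solomon A.
Proof.
split; [exact: explicit_one | exact: explicit_local_bicomplex |].
move=> Sigma sS i j ij; have := explicit_exact sS ij; by case: (chi Sigma) => h p [] e;
  apply: h; rewrite -e ?leqnSn.
Qed.

End ExplicitSubquotient.

(** * Uniqueness of the Orlik-Solomon bi-complex *)

(** Comparison maps are known only through the property of their values; a choice function for a
    single-valued linear relation is automatically linear. *)
Lemma linear_relation_fun (F : fieldType) (V V' : vectType F) (Rel : V -> V' -> Prop) :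
  (forall x, exists y, Rel x y) ->
  (forall x y y', Rel x y -> Rel x y' -> y = y') ->
  (forall a x y x' y', Rel x y -> Rel x' y' -> Rel (a *: x + x') (a *: y + y')) ->
  exists f : 'Hom(V, V'), forall x, Rel x (f x).
Proof.
move=> tot fn lin; pose f x := sval (boolp.cid (tot x)).
have fP x : Rel x (f x) by apply: svalP (boolp.cid (tot x)).
have fl : linear f by move=> a x y; apply: fn (fP _) (lin _ _ _ _ _ (fP x) (fP y)).
pose f' : {linear V -> V'} := HB.pack f (GRing.isLinear.Build _ _ _ _ f fl).
by exists (linfun f') => x; rewrite lfunE; apply: fP.
Qed.

Section Uniqueness.
Variables (K : fieldType) (n l m : nat) (B : biarrangement K n l m).
Local Notation L := (bi_L B).
Local Notation M := (bi_M B).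
Local Notation stratum := (stratum L M).
Local Notation strata := (strata L M).
Local Notation chi := (bi_chi B).

Lemma codimS (S T : stratum) : (S <= T)%VS -> (codim T <= codim S)%N.
Proof. by move=> ST; rewrite leq_sub2l // dimvS. Qed.

Lemma stratum_eq_codim (S T : stratum) : (S <= T)%VS -> codim S = codim T -> S = T.
Proof.
move=> ST cST; apply: val_inj; apply/eqP; rewrite eqEdim ST /=.
have dn (X : {vspace 'rV[K]_n}) : (\dim X <= n)%N.
  by have := dimvS (subvf X); rewrite [\dim {:_}]dimvf /dim /= mul1n.
move: cST; rewrite /codim => /(congr1 (fun x => n - x)%N).
by rewrite !subKn ?dn // => ->.
Qed.

Lemma codim_strict (S : stratum) : (0 < codim S)%N -> strict S.
Proof.
apply: contraTneq => e; rewrite /codim e dimvf /dim /= mul1n subnn //.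
Qed.

Lemma strata_codim r (S : strata r) : codim (val S) = r.
Proof. exact/eqP/(valP S). Qed.

Lemma above_lt_false (Sigma : stratum) r (S : above Sigma r) : (codim Sigma < r)%N -> False.
Proof.
by have := codimS (valP S); rewrite strata_codim ltnNge => ->.
Qed.

Definition above_self r (S : strata r) : above (val S) r := exist _ S (subvv _).

Lemma above_selfE r (S : strata r) (T : above (val S) r) : T = above_self S.
Proof.
apply/val_inj/val_inj/esym/stratum_eq_codim => /=; first exact: (valP T).
by rewrite !strata_codim.
Qed.

(** * Consequences of the exact sequences in one bi-complex *)

Section LocalSums.
Variables (A : bicomplex_data B).
Implicit Type Sigma : stratum.

Definition single Sigma i j (T : above Sigma (i + j)) (t : bc_space A (val T)) :
  local_sum A Sigma i j := dfwith (fun T' => 0 : bc_space A (val T')) t.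

Lemma singleE Sigma i j (T : above Sigma (i + j)) (t : bc_space A (val T)) :
  single t T = t.
Proof. exact: dfwith_in. Qed.

Lemma single_neq Sigma i j (T T' : above Sigma (i + j)) (t : bc_space A (val T)) :
  T != T' -> single t T' = 0.
Proof. exact: dfwith_out. Qed.

Lemma local_d1_self i j (S : strata (i.+1 + j)) (x : local_sum A (val S) i.+1 j)
    (T : above (val S) (i + j)) :
  local_d1 x T = bc_d1 A S (val T) (x (above_self S)).
Proof.
rewrite /local_d1 (big_pred1 (above_self S)) // => S'.
by rewrite /= [S']above_selfE eqxx; apply: (valP T).
Qed.

Lemma local_d2_self i j (S : strata (i + j.+1)) (x : local_sum A (val S) i j) :
  local_d2 x (above_self S) = \sum_(T : above (val S) (i + j)) bc_d2 A S (val T) (x T).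
Proof. by apply: eq_bigl => T; apply: (valP T). Qed.

Lemma local_d2_ext Sigma i j (x y : local_sum A Sigma i j) S :
  (forall T, x T = y T) -> local_d2 x S = local_d2 y S.
Proof. by move=> xy; apply: eq_bigr => T _; rewrite xy. Qed.

Lemma local_d2_zero Sigma i j (x : local_sum A Sigma i j) S :
  (forall T, x T = 0) -> local_d2 x S = 0.
Proof. by move=> x0; apply: big1 => T _; rewrite x0 linear0. Qed.

Lemma local_d2_linear Sigma i j a (x y : local_sum A Sigma i j) S :
  local_d2 ((fun T => a *: x T + y T) : local_sum A Sigma i j) S =
  a *: local_d2 x S + local_d2 y S.
Proof.
rewrite scaler_sumr -big_split; apply: eq_bigr => T _.
by rewrite linearP.
Qed.

Lemma local_d2_single i j (S : strata (i + j.+1)) (T : strata (i + j))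
    (ST : (val S <= val T)%VS) (t : bc_space A T) :
  local_d2 (single (T := exist _ T ST : above (val S) (i + j)) t) (above_self S) =
  bc_d2 A S T t.
Proof.
rewrite local_d2_self (bigD1 (exist _ T ST)) //= singleE big1 ?addr0 // => T' TT'.
by rewrite single_neq ?linear0 // eq_sym.
Qed.

Hypothesis OS_A : is_Orlik_Solomon A.

Lemma OS_row i j (S : strata (i + j)) p : (0 < i + j)%N -> chi (val S) = Lambda ->
  p = i \/ p.+1 = i -> row_exact_at A (val S) p j.
Proof.
move=> r0 c; have [_ _ /(_ (val S))] := OS_A.
rewrite codim_strict ?strata_codim // => /(_ isT) /(_ i j); rewrite strata_codim c.
by move=> /(_ erefl) h; apply: h.
Qed.

Lemma OS_column i j (S : strata (i + j)) q : (0 < i + j)%N -> chi (val S) = Mu ->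
  q = j \/ q.+1 = j -> column_exact_at A (val S) i q.
Proof.
move=> r0 c; have [_ _ /(_ (val S))] := OS_A.
rewrite codim_strict ?strata_codim // => /(_ isT) /(_ i j); rewrite strata_codim c.
by move=> /(_ erefl) h; apply: h.
Qed.

(** For [i = 0] the exact row reduces to $0 \to A_{0,j}^S \to 0$. *)
Lemma OS_lambda0 j (S : strata (0 + j)) (x : bc_space A S) : (0 < j)%N ->
  chi (val S) = Lambda -> x = 0.
Proof.
move=> j0 c; have := @OS_row 0 j S 0 j0 c (or_introl erefl).
move=> /(_ (single (T := above_self S) x) I) [y /(_ (above_self S))].
rewrite singleE => <-; apply: big1 => T _.
by case: (above_lt_false T); rewrite strata_codim.
Qed.

Lemma OS_lambda_inj i j (S : strata (i.+1 + j)) (x : bc_space A S) :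
  chi (val S) = Lambda ->
  (forall T : strata (i + j), (val S <= val T)%VS -> bc_d1 A S T x = 0) -> x = 0.
Proof.
move=> c x0; have := @OS_row i.+1 j S i.+1 isT c (or_introl erefl).
move=> /(_ (single (T := above_self S) x)) [T | y /(_ (above_self S))].
  by rewrite local_d1_self singleE x0 //; apply: (valP T).
rewrite singleE => <-; apply: big1 => T _.
by case: (above_lt_false T); rewrite strata_codim.
Qed.

(** For [j = 0] the exact column reduces to $0 \to A_{i,0}^S \to 0$. *)
Lemma OS_mu0 i (S : strata (i + 0)) (x : bc_space A S) : (0 < i)%N ->
  chi (val S) = Mu -> x = 0.
Proof.
move=> i0 c; have i0' : (0 < i + 0)%N by rewrite addn0.
have := @OS_column i 0 S 0 i0' c (or_introl erefl).
move=> /(_ (single (T := above_self S) x)) => h.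
etransitivity; [symmetry; exact: (singleE (T := above_self S) x) | apply: (h _ (above_self
  S)) => T].
by case: (above_lt_false T); rewrite strata_codim addnS.
Qed.

Lemma OS_mu_surj i j (S : strata (i + j.+1)) (x : bc_space A S) :
  chi (val S) = Mu ->
  exists w : local_sum A (val S) i j, local_d2 w (above_self S) = x.
Proof.
have ij0 : (0 < i + j.+1)%N by rewrite addnS.
move=> c; have := @OS_column i j.+1 S j.+1 ij0 c (or_introl erefl).
move=> /(_ (single (T := above_self S) x)) [T | w h].
  by case: (above_lt_false T); rewrite strata_codim !addnS.
by exists w; rewrite h singleE.
Qed.

Lemma OS_row_lift i j (S : strata (i.+1 + j)) (z : local_sum A (val S) i j) :
  chi (val S) = Lambda ->
  match i return local_sum A (val S) i j -> Prop with
    | 0 => fun=> True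
    | i'.+1 => fun z => forall T, local_d1 z T = 0
  end z ->
  exists x, forall T, bc_d1 A S (val T) x = z T.
Proof.
move=> c z0; have [y yz] := @OS_row i.+1 j S i isT c (or_intror erefl) z z0.
by exists (y (above_self S)) => T; rewrite -yz local_d1_self.
Qed.

Lemma OS_column_lift i j (S : strata (i + j.+1)) (w : local_sum A (val S) i j) :
  chi (val S) = Mu -> local_d2 w (above_self S) = 0 ->
  match j return local_sum A (val S) i j -> Prop with
    | 0 => fun w => forall T, w T = 0
    | j'.+1 => fun w => exists v : local_sum A (val S) i j', forall T, local_d2 v T = w T
  end w.
Proof.
have ij0 : (0 < i + j.+1)%N by rewrite addnS.
move=> c w0; have h := @OS_column i j.+1 S j ij0 c (or_intror erefl).
have w0' S' : local_d2 w S' = 0 by rewrite [S']above_selfE.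
by case: j {ij0} S w c w0 h w0' => [|j] S w c w0 h w0'; apply: h w0'.
Qed.

End LocalSums.

(** * Extending a comparison map by one codimension *)

Section Comparison.
Variables A A' : bicomplex_data B.
Variable phi : forall i j (S : strata (i + j)), 'Hom(bc_space A S, bc_space A' S).

Definition commutes_upto r : Prop :=
  (forall i j (S : strata (i.+1 + j)) (T : strata (i + j)) x,
     (i.+1 + j <= r)%N -> (val S <= val T)%VS ->
     phi T (bc_d1 A S T x) = bc_d1 A' S T (phi S x)) /\
  (forall i j (S : strata (i + j.+1)) (T : strata (i + j)) x,
     (i + j.+1 <= r)%N -> (val S <= val T)%VS ->
     phi S (bc_d2 A S T x) = bc_d2 A' S T (phi T x)).

(** [f] is a candidate at [S], tested against [phi] on the smaller codimension; in degree 0 no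
    differential $d'$ leaves [S]. *)
Definition compatible_d1 i : forall j (S : strata (i + j)),
    'Hom(bc_space A S, bc_space A' S) -> Prop :=
  match i with
  | 0 => fun j S f => True
  | i'.+1 => fun j S f => forall (T : strata (i' + j)) x, (val S <= val T)%VS ->
      phi T (bc_d1 A S T x) = bc_d1 A' S T (f x)
  end.

Definition compatible_d2 i j : forall (S : strata (i + j)),
    'Hom(bc_space A S, bc_space A' S) -> Prop :=
  match j with
  | 0 => fun S f => True
  | j'.+1 => fun S f => forall (T : strata (i + j')) x, (val S <= val T)%VS ->
      f (bc_d2 A S T x) = bc_d2 A' S T (phi T x)
  end.

Definition local_map Sigma i j (x : local_sum A Sigma i j) : local_sum A' Sigma i j :=
  fun S => phi (val S) (x S).

Variable r : nat.
Hypothesis phiC : commutes_upto r.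

Lemma local_map_d1 Sigma i j (x : local_sum A Sigma i.+1 j) T : (i.+1 + j <= r)%N ->
  local_d1 (local_map x) T = phi (val T) (local_d1 x T).
Proof.
move=> ir; rewrite linear_sum; apply: eq_bigr => S ST /=.
by have [h _] := phiC; rewrite h.
Qed.

Lemma local_map_d2 Sigma i j (x : local_sum A Sigma i j) S : (i + j.+1 <= r)%N ->
  local_d2 (local_map x) S = phi (val S) (local_d2 x S).
Proof.
move=> ir; rewrite linear_sum; apply: eq_bigr => T ST /=.
by have [_ h] := phiC; rewrite h.
Qed.

Hypothesis OS_A : is_Orlik_Solomon A.
Hypothesis OS_A' : is_Orlik_Solomon A'.

(** Commuting $d'$ past $d''$ in both bi-complexes avoids the stratum [S] of codimension [r.+1], so
    only the known range of [phi] is used. This gives compatibility with the differential that does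
    not define the map. *)
Lemma d1_local_d2 i j (S : strata (i.+1 + j.+1)) (w : local_sum A (val S) i.+1 j)
    (T : strata (i + j.+1)) : (i + j.+1)%N = r -> (val S <= val T)%VS ->
  phi T (bc_d1 A S T (local_d2 w (above_self S))) =
  bc_d1 A' S T (local_d2 (local_map w) (above_self S)).
Proof.
move=> ir ST; pose T' : above (val S) (i + j.+1) := exist _ T ST.
have [_ /(_ (val S)) [_ _ C] _] := OS_A; have [_ /(_ (val S)) [_ _ C'] _] := OS_A'.
rewrite -[bc_d1 A S T _]/(bc_d1 A S (val T') _) -[bc_d1 A' S T _]/(bc_d1 A' S (val T') _).
rewrite -!local_d1_self C C' -[T]/(val T') -local_map_d2 ?ir //.
by apply: local_d2_ext => Z; rewrite local_map_d1 // -ir addnS addSn.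
Qed.

(** For colour lambda the value at [x] is the unique preimage under $d'$ of the cycle [phi] $(d'x)$.
    For colour mu one writes $x = d''w$ and takes $d''$ of the image of [w]. *)
Lemma exists_compatible i j (S : strata (i + j)) : (i + j)%N = r.+1 ->
  exists f, @compatible_d1 i j S f /\ @compatible_d2 i j S f.
Proof.
move=> ir; case c: (chi (val S)).
  case: i S ir c => [|i] S ir c.
    exists 0; split=> //; case: j S ir c => [|j] S ir c //= T x ST.
    by rewrite lfunE /= (OS_lambda0 OS_A' (bc_d2 A' S T _)).
  have [f fP] : exists f : 'Hom(bc_space A S, bc_space A' S), forall x,
      forall T : strata (i + j), (val S <= val T)%VS ->
      phi T (bc_d1 A S T x) = bc_d1 A' S T (f x).
    apply: (@linear_relation_fun _ _ _ (fun x y => forall T : strata (i + j),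
       (val S <= val T)%VS -> phi T (bc_d1 A S T x) = bc_d1 A' S T y)).
    - move=> x; pose z := local_map (local_d1 (single (T := above_self S) x)).
      have [|y yz] := OS_row_lift (z := z) OS_A' c.
        case: i {c} S ir x @z => [|i] S ir x z //= T.
        rewrite /z local_map_d1; last by rewrite -ltnS -ir.
        by have [_ /(_ (val S)) [-> _ _] _] := OS_A; rewrite linear0.
      exists y => T ST; have := yz (exist _ T ST); rewrite /= => ->.
      by rewrite /z /local_map local_d1_self singleE.
    - move=> x y y' h h'; apply/eqP; rewrite -subr_eq0; apply/eqP.
      by apply: (OS_lambda_inj OS_A' c) => T ST; rewrite linearB /= -h -?h' // subrr.
    - by move=> a x y x' y' h h' T ST; rewrite !linearP /= h ?h'.
  exists f; split; first by move=> T x ST; apply: fP.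
  case: j S ir c f fP => [|j] S ir c f fP //= T x ST.
  (* The identity for $d''$ is tested after applying the maps $d'$, which are jointly injective on
     [S]. *)
  apply/eqP; rewrite -subr_eq0; apply/eqP; apply: (OS_lambda_inj OS_A' c) => T' ST'.
  rewrite linearB /= -fP // -(local_d2_single ST) d1_local_d2 //; last by case: ir.
  rewrite -linearB /= local_d2_self (bigD1 (exist _ T ST)) //= /local_map singleE.
  rewrite big1 ?addr0 ?subrr ?linear0 // => T'' TT''.
  by rewrite single_neq ?linear0 // eq_sym.
case: j S ir c => [|j] S ir c.
  exists 0; split=> //; case: i S ir c => [|i] S ir c //= T x ST.
  by rewrite lfunE /= (OS_mu0 OS_A x) // !linear0.
(* Independence of the choice of [w]: a family killed by $d''$ is itself a $d''$-image, or 0 when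
   [j = 0], and [phi] preserves this. *)
have push (w : local_sum A (val S) i j) : local_d2 w (above_self S) = 0 ->
    local_d2 (local_map w) (above_self S) = 0.
  move=> /(OS_column_lift OS_A c).
  case: j S ir c w => [|j] S ir c w.
    by move=> w0; apply: local_d2_zero => T; rewrite /local_map w0 linear0.
  case=> v vw; rewrite (local_d2_ext (y := local_d2 (local_map v))) => [|T].
    by have [_ /(_ (val S)) [_ -> _] _] := OS_A'.
  by rewrite local_map_d2; [rewrite /local_map vw | rewrite -ltnS -ir !addnS].
have [f fP] : exists f : 'Hom(bc_space A S, bc_space A' S), forall x,
    exists2 w : local_sum A (val S) i j, local_d2 w (above_self S) = x &
      local_d2 (local_map w) (above_self S) = f x.
  apply: (@linear_relation_fun _ _ _ (fun x y => exists2 w : local_sum A (val S) i j,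
      local_d2 w (above_self S) = x & local_d2 (local_map w) (above_self S) = y)).
  - by move=> x; have [w wx] := OS_mu_surj OS_A x c;
    exists (local_d2 (local_map w) (above_self S)), w.
  - move=> x _ _ [w wx <-] [w' wx' <-].
    pose d : local_sum A (val S) i j := fun T => -1 *: w T + w' T.
    have := push d; rewrite local_d2_linear wx wx' scaleN1r addNr => /(_ erefl).
    rewrite (local_d2_ext (y := (fun T => -1 *: local_map w T + local_map w' T) : local_sum
      A' _ _ _)) => [|T].
      by rewrite local_d2_linear scaleN1r => /eqP; rewrite addrC subr_eq0 => /eqP.
    by rewrite /local_map linearP.
  - move=> a _ _ _ _ [w <- <-] [w' <- <-].
    exists (fun T => a *: w T + w' T); first by rewrite local_d2_linear.
    rewrite -local_d2_linear; apply: local_d2_ext => T.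
    by rewrite /local_map linearP.
exists f; split.
  case: i S ir c push f fP => [|i] S ir c push f fP //= T x ST.
  by have [w <- <-] := fP x; rewrite d1_local_d2 //; case: ir.
move=> T x ST /=; have [w wx <-] := fP (bc_d2 A S T x).
(* [w] and the family concentrated at [T] have the same image under $d''$, so [push] applies to
   their difference. *)
pose s : local_sum A (val S) i j := single (T := exist _ T ST : above _ _) x.
pose d : local_sum A (val S) i j := fun T => -1 *: s T + w T.
have := push d; rewrite local_d2_linear wx local_d2_single scaleN1r addNr => /(_ erefl).
rewrite (local_d2_ext (y := (fun T => -1 *: local_map s T + local_map w T) : local_sum A' _
  _ _)) => [|T']; last first.
  by rewrite /local_map linearP.
rewrite local_d2_linear scaleN1r addrC => /eqP; rewrite subr_eq0 => /eqP ->.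
rewrite local_d2_self (bigD1 (exist _ T ST)) //= /local_map /s singleE.
rewrite big1 ?addr0 // => T'' TT''.
by rewrite single_neq ?linear0 // eq_sym.
Qed.

End Comparison.

End Uniqueness.

(** * Isomorphism of two bi-complexes and transfer of exactness *)

Section Isomorphism.
Variables (K : fieldType) (n l m : nat) (B : biarrangement K n l m).
Local Notation L := (bi_L B).
Local Notation M := (bi_M B).
Local Notation stratum := (stratum L M).
Local Notation strata := (strata L M).
Local Notation chi := (bi_chi B).
Local Notation family A A' :=
  (forall i j (S : strata (i + j)), 'Hom(bc_space A S, bc_space A' S)).

Definition inverse_upto (A A' : bicomplex_data B) (phi : family A A') (psi : family A' A) r :=
  forall i j (S : strata (i + j)) x, (i + j <= r)%N -> psi i j S (phi i j S x) = x.

Lemma ambient_unique (S : strata 0) : S = ambient L M.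
Proof.
apply: val_inj; apply: stratum_eq_codim; last by rewrite !strata_codim.
by rewrite {2}/stratum_space /= /Defs.flat !big_set0 capfv subvf.
Qed.

(** Rigidity, to be applied to a composite of two comparison maps: [f] is pinned down by the
    injectivity of $d'$ for colour lambda and by the surjectivity of $d''$ for colour mu. *)
Lemma compatible_unique (A : bicomplex_data B) i j (S : strata (i + j))
    (f : bc_space A S -> bc_space A S) :
  is_Orlik_Solomon A -> (0 < i + j)%N -> linear f ->
  (match i return forall j (S : strata (i + j)), (bc_space A S -> bc_space A S) -> Prop with
   | 0 => fun j S f => True
   | i'.+1 => fun j S f => forall (T : strata (i' + j)) x, (val S <= val T)%VS ->
       bc_d1 A S T x = bc_d1 A S T (f x)
   end j S f) ->
  (match j return forall (S : strata (i + j)), (bc_space A S -> bc_space A S) -> Prop with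
   | 0 => fun S f => True
   | j'.+1 => fun S f => forall (T : strata (i + j')) x, (val S <= val T)%VS ->
       f (bc_d2 A S T x) = bc_d2 A S T x
   end S f) ->
  forall x, f x = x.
Proof.
move=> OS_A ij0 fl; case c: (chi (val S)).
  case: i S f ij0 fl c => [|i] S f ij0 fl c f1 f2 x.
    by rewrite (OS_lambda0 OS_A (f x)) // (OS_lambda0 OS_A x).
  apply/eqP; rewrite -subr_eq0; apply/eqP; apply: (OS_lambda_inj OS_A c) => T ST.
  by rewrite linearB /= -f1 // subrr.
case: j S f ij0 fl c => [|j] S f ij0 fl c f1 f2 x.
  rewrite addn0 in ij0.
  by rewrite (OS_mu0 OS_A (f x)) // (OS_mu0 OS_A x).
have [w <-] := OS_mu_surj OS_A x c; rewrite local_d2_self.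
pose F : {linear _ -> _} := HB.pack f (GRing.isLinear.Build _ _ _ _ f fl).
rewrite -[f]/(F : _ -> _) linear_sum; apply: eq_bigr => T _.
by apply: f2; apply: (valP T).
Qed.

Lemma extend_family (A A' : bicomplex_data B) (phi : family A A') r :
  is_Orlik_Solomon A -> is_Orlik_Solomon A' -> commutes_upto phi r ->
  exists phi' : family A A',
    [/\ forall i j S, (i + j <= r)%N -> phi' i j S = phi i j S,
        forall i j (S : strata (i + j)), (i + j)%N = r.+1 ->
          compatible_d1 phi (phi' i j S) /\ compatible_d2 phi (phi' i j S)
      & commutes_upto phi' r.+1].
Proof.
move=> OS_A OS_A' phiC.
(* Both ranges of codimension are stated as implications about one [f], so that a single choice
   defines the new family at every index without a cast. *)
have ex i j (S : strata (i + j)) : exists f : 'Hom(bc_space A S, bc_space A' S),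
    ((i + j <= r)%N -> f = phi i j S) /\
    ((i + j)%N = r.+1 -> compatible_d1 phi f /\ compatible_d2 phi f).
  have [e | ne] := eqVneq (i + j)%N r.+1.
    have [f fP] := exists_compatible phiC OS_A OS_A' S e.
    by exists f; split=> //; rewrite e ltnn.
  by exists (phi i j S); split=> // e; rewrite e eqxx in ne.
pose phi' i j S := sval (boolp.cid (ex i j S)).
have phi'P i j S : ((i + j <= r)%N -> phi' i j S = phi i j S) /\
    ((i + j)%N = r.+1 -> compatible_d1 phi (phi' i j S) /\ compatible_d2 phi (phi' i j S)).
  exact: svalP (boolp.cid (ex i j S)).
have low i j (S : strata (i + j)) (le : (i + j <= r)%N) : phi' i j S = phi i j S.
  exact: (phi'P i j S).1 le.
have top i j (S : strata (i + j)) (e : (i + j)%N = r.+1) :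
    compatible_d1 phi (phi' i j S) /\ compatible_d2 phi (phi' i j S).
  exact: (phi'P i j S).2 e.
exists phi'; split=> //; have [C1 C2] := phiC.
split=> i j S T x; rewrite leq_eqVlt => /orP [/eqP e | lt] ST.
- rewrite (low i j T); last by rewrite -ltnS -e.
  by have [h _] := top i.+1 j S e; apply: h.
- rewrite (low i j T); last exact: ltnW.
  by rewrite (low i.+1 j S) //; apply: C1.
- rewrite (low i j T); last by rewrite -ltnS -e addnS.
  by have [_ h] := top i j.+1 S e; apply: h.
- rewrite (low i j T); last by apply: ltnW; rewrite -addnS.
  by rewrite (low i j.+1 S) //; apply: C2.
Qed.

Lemma extend_inverse (A A' : bicomplex_data B) (phi phi' : family A A') (psi psi' : family
  A' A) r :
  is_Orlik_Solomon A ->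
  (forall i j S, (i + j <= r)%N -> phi' i j S = phi i j S) ->
  (forall i j (S : strata (i + j)), (i + j)%N = r.+1 ->
     compatible_d1 phi (phi' i j S) /\ compatible_d2 phi (phi' i j S)) ->
  (forall i j S, (i + j <= r)%N -> psi' i j S = psi i j S) ->
  (forall i j (S : strata (i + j)), (i + j)%N = r.+1 ->
     compatible_d1 psi (psi' i j S) /\ compatible_d2 psi (psi' i j S)) ->
  inverse_upto phi psi r -> inverse_upto phi' psi' r.+1.
Proof.
move=> OS_A phiE phiP psiE psiP inv i j S x; rewrite leq_eqVlt => /orP [/eqP e | lt]; last first.
  by rewrite phiE ?psiE //; apply: inv.
have [f1 f2] := phiP i j S e; have [g1 g2] := psiP i j S e.
apply: (compatible_unique (f := fun x => psi' i j S (phi' i j S x)) OS_A _ _ _ _ x).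
- by rewrite e.
- by move=> a y z; rewrite !linearP.
- case: i S x e f1 f2 g1 g2 => [|i] S x e f1 f2 g1 g2 //= T y ST.
  by rewrite -g1 // -f1 // inv //; rewrite -ltnS -e.
- case: j S x e f1 f2 g1 g2 => [|j] S x e f1 f2 g1 g2 //= T y ST.
  by rewrite f2 // g2 // inv //; rewrite -ltnS -e addnS.
Qed.

(** The bound [r] lets the maps be re-chosen at each step of the induction; only the identification
    of [bc_one] with [bc_one] starts it. *)
Lemma Orlik_Solomon_iso (A A' : bicomplex_data B) r :
  is_Orlik_Solomon A -> is_Orlik_Solomon A' ->
  exists (phi : family A A') (psi : family A' A),
    [/\ commutes_upto phi r, commutes_upto psi r,
        inverse_upto phi psi r & inverse_upto psi phi r].
Proof.
move=> OS_A OS_A'; elim: r => [|r [phi [psi [phiC psiC inv1 inv2]]]]; last first.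
  have [phi' [phiE phiP phiC']] := extend_family OS_A OS_A' phiC.
  have [psi' [psiE psiP psiC']] := extend_family OS_A' OS_A psiC.
  exists phi', psi'; split=> //.
    exact: extend_inverse phiE phiP psiE psiP inv1.
  exact: extend_inverse psiE psiP phiE phiP inv2.
have base (C C' : bicomplex_data B) : is_Orlik_Solomon C ->
    exists phi : family C C', phi 0 0 (ambient L M) (bc_one C) = bc_one C'.
  move=> [[nz gen] _ _].
  have [f fP] : exists f : 'Hom(bc_space C (i := 0) (j := 0) (ambient L M),
      bc_space C' (i := 0) (j := 0) (ambient L M)), forall x,
      exists2 a, x = a *: bc_one C & f x = a *: bc_one C'.
    apply: (@linear_relation_fun _ _ _ (fun x y => exists2 a, x = a *: bc_one C & y = a *:
      bc_one C')).
    - move=> x; have : x \in <[bc_one C]>%VS by rewrite -gen memvf.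
      by case/vlineP => a ->; exists (a *: bc_one C'), a.
    - move=> _ _ _ [a -> ->] [b e ->]; congr (_ *: _); apply/eqP.
      have := congr1 (fun z => z - b *: bc_one C) e; rewrite subrr -scalerBl => /eqP.
      by rewrite scaler_eq0 (negPf nz) orbF subr_eq0.
    - move=> a _ _ _ _ [b -> ->] [c -> ->]; exists (a * b + c).
        by rewrite scalerDl scalerA.
      by rewrite scalerDl scalerA.
  (* The family must be defined at all indices but is prescribed at [ambient] only, so [bc_one] is
     transported along an equality with [S]; [eq_axiomK] removes the transport afterwards. *)
  have ex i j (S : strata (i + j)) : exists g : 'Hom(bc_space C S, bc_space C' S),
      match i, j return forall S : strata (i + j), 'Hom(bc_space C S, bc_space C' S) -> Prop with
      | 0, 0 => fun S g => exists e : ambient L M = S,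
          g (eq_rect _ (fun S : strata (0 + 0) => bc_space C S) (bc_one C) S e) =
          eq_rect _ (fun S : strata (0 + 0) => bc_space C' S) (bc_one C') S e
      | _, _ => fun _ _ => True
      end S g.
    case: i S => [|i] S; last by exists 0.
    case: j S => [|j] S; last by exists 0.
    have e := ambient_unique S; rewrite {S}e; exists f, erefl => /=.
    have [a e ->] := fP (bc_one C); move/eqP: e.
    rewrite -{1}[bc_one C]scale1r -subr_eq0 -scalerBl scaler_eq0 (negPf nz) orbF subr_eq0.
    by move/eqP <-; rewrite scale1r.
  exists (fun i j S => sval (boolp.cid (ex i j S))).
  have [e] := svalP (boolp.cid (ex 0 0 (ambient L M))).
  by rewrite (eq_axiomK e).
have [phi phi1] := base A A' OS_A; have [psi psi1] := base A' A OS_A'.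
have vac (C C' : bicomplex_data B) (f : family C C') : commutes_upto f 0.
  by split=> i j S T x le; exfalso; move: le; rewrite ?addSn ?addnS ltn0.
have id0 (C C' : bicomplex_data B) (f : family C C') (g : family C' C) :
    is_Orlik_Solomon C -> f 0 0 (ambient L M) (bc_one C) = bc_one C' ->
    g 0 0 (ambient L M) (bc_one C') = bc_one C -> inverse_upto f g 0.
  move=> [[_ gen] _ _] f1 g1 i j S x; case: i S x => [|i] S x; last by rewrite addSn.
  case: j S x => [|j] S x // _; move: x; rewrite [S]ambient_unique => x.
  have : x \in <[bc_one C]>%VS by rewrite -gen memvf.
  by case/vlineP => a ->; rewrite !linearZ /= f1 g1.
exists phi, psi; split; [exact: vac | exact: vac | exact: id0 | exact: id0].
Qed.

Lemma exact_transfer (A A' : bicomplex_data B) (Sigma : stratum) :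
  is_Orlik_Solomon A -> is_Orlik_Solomon A' -> exact_stratum A' Sigma -> exact_stratum A Sigma.
Proof.
move=> OS_A OS_A' exA' i j ij; have := exA' i j ij.
(* Exactness at one place involves strata of bounded codimension, so isomorphisms up to a bound
   suffice. *)
have row p : row_exact_at A' Sigma p j -> row_exact_at A Sigma p j.
  have [phi [psi [phiC psiC inv1 inv2]]] := Orlik_Solomon_iso (p.+2 + j) OS_A OS_A'.
  have le1 : (p.+1 + j <= p.+2 + j)%N by rewrite leq_add2r.
  have le0 : (p + j <= p.+2 + j)%N by rewrite leq_add2r; apply: leqW.
  move=> ex x x0; have [|y yx] := ex (local_map phi x).
    case: p phi psi phiC psiC inv1 inv2 le1 le0 ex x x0 => [|p] phi psi phiC psiC inv1 inv2
      le1 le0 ex x x0 //= T.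
    by rewrite (local_map_d1 phiC) // x0 linear0.
  by exists (local_map psi y) => S; rewrite (local_map_d1 psiC) // yx /local_map inv1.
have column q : column_exact_at A' Sigma i q -> column_exact_at A Sigma i q.
  have [phi [psi [phiC psiC inv1 inv2]]] := Orlik_Solomon_iso (i + q.+2) OS_A OS_A'.
  have le1 : (i + q.+1 <= i + q.+2)%N by rewrite leq_add2l.
  have le0 : (i + q <= i + q.+2)%N by rewrite leq_add2l; apply: leqW.
  case: q phi psi phiC psiC inv1 inv2 le1 le0 => [|q] phi psi phiC psiC inv1 inv2 le1 le0 ex x x0.
    move=> T; rewrite -[x T]inv1 //.
    rewrite -[phi i 0 (val T) (x T)]/(local_map phi x T) ex ?linear0 // => S.
    by rewrite (local_map_d2 phiC) // x0 linear0.
  have [S|y yx] := ex (local_map phi x).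
    by rewrite (local_map_d2 phiC) // x0 linear0.
  by exists (local_map psi y) => S; rewrite (local_map_d2 psiC) // yx /local_map inv1.
case: (chi Sigma) => h p pi; first by apply: row; apply: h.
by apply: column; apply: h.
Qed.

End Isomorphism.

From mathcomp Require Import reals complex.

Theorem theorem1p2 (R : realType) (n l m : nat)
    (B : biarrangement (complex R) n l m) (tameB : tame B) :
  is_exact B
  /\
  [/\ passes_to_subquotient B (linfun (@tensor_d1 l m)),
      passes_to_subquotient B (linfun (@tensor_d2 l m)),
      expl_decomposition B
    & is_Orlik_Solomon (expl_bicomplex B)].
Proof.
have OS_B := explicit_Orlik_Solomon tameB.
split; last first.
  split; [exact: passes_d1 | exact: passes_d2 | exact: explicit_decomposition | exact: OS_B].
move=> A OS_A Sigma sS.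
exact: exact_transfer OS_A OS_B (explicit_exact tameB sS).
Qed.
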